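(* Let $\pi,\pi'$ be irreducible smooth $\psi_U$-generic representations of $\mathrm{Sp}_{2n}(F)$ with the same central character, let $v\in V_\pi$, $v'\in V_{\pi'}$ with $W_v(1)=W_{v'}(1)=1$, and let $C$ be a positive integer such that $\pi(k)v=v$ and $\pi'(k)v'=v'$ for all $k\in K_C$. Let $w\in\mathbf{W}$ with $w\le w_0$. Let $a_t$, $0\le t\le l(w)$, be integers with $a_0=0$ and $a_t\ge t+a_{t-1}$ for $1\le t\le l(w)$, and let $m$ be an integer with $m\ge 4^{a_{l(w)}}C$. (1) If $W_{v_k}(tw')=W_{v'_k}(tw')$ for all $w'<w$, all $k\ge 4^{a_{l(w')}}C$ and all $t\in T$, then $W_{v_m}(twu)=W_{v'_m}(twu)$ for all $t\in T$ and all $u\in U_w^-\setminus U^-_{w,m}$. (2) If $W_{v_k}(tw')=W_{v'_k}(tw')$ for all $w'\le w$, all $k\ge 4^{a_{l(w')}}C$ and all $t\in T$, then $W_{v_m}(g)=W_{v'_m}(g)$ for all $g\in BwB$.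
   Context: $F$ is a $p$-adic field, $\mathcal{O}$ its ring of integers, $\mathcal{P}$ its maximal ideal, $\varpi$ a uniformizer; $n>1$. $\mathrm{Sp}_{2n}(F)$ is the symplectic group of $\begin{pmatrix}0&J_n\\-J_n&0\end{pmatrix}$ ($J_n$ the antidiagonal matrix of ones). $U$ = upper triangular unipotent subgroup, $T$ = diagonal torus $t=\mathrm{diag}(a_1,\dots,a_n,a_n^{-1},\dots,a_1^{-1})$, $B=TU$. Simple roots $\alpha_i(t)=a_i/a_{i+1}$ ($1\le i\le n-1$), $\beta(t)=a_n^2$; $\Sigma^+$ the positive roots, $U_\gamma$ the root subgroup of $\gamma$. $\psi$ is an additive character of $F$ with conductor $\mathcal{O}$, $\psi_U((u_{ij}))=\psi(\sum_{i=1}^nu_{i,i+1})$. For an irreducible $\psi_U$-generic $\pi$ fix a nonzero $\lambda_\pi\in\mathrm{Hom}_U(\pi,\psi_U)$ and set $W_v(g)=\lambda_\pi(\pi(g)v)$ (similarly for $\pi'$). For $m\ge1$: $K_m=(I_{2n}+\mathrm{Mat}_{2n}(\mathcal{P}^m))\cap\mathrm{Sp}_{2n}(F)$; $\tau_m((k_{ij}))=\psi(\varpi^{-2m}\sum_{i=1}^nk_{i,i+1})$ on $K_m$; $d_m=\mathrm{diag}(\varpi^{-(2n-1)m},\varpi^{-(2n-3)m},\dots,\varpi^{-m},\varpi^{m},\dots,\varpi^{(2n-1)m})$; $H_m=d_mK_md_m^{-1}$; $\psi_m(h)=\tau_m(d_m^{-1}hd_m)$; $U_m=U\cap H_m$;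 Howe vectors $v_m=\mathrm{vol}(U_m)^{-1}\int_{U_m}\psi_m(u)^{-1}\pi(u)v\,du$, and $v'_m$ likewise. $\mathbf{W}=N(T)/T$ is the Weyl group, generated by the simple reflections $s_{\alpha_i},s_\beta$; expressions $W(tw)$ are evaluated at a fixed representative of $w$ in $N(T)$ (the statements are for all $t\in T$). $l(w)$ is the length; the Bruhat order: $w'\le w$ if $w'$ is a subexpression of a reduced expression of $w$, $w'<w$ if moreover $w'\ne w$. $w_0=s_{\alpha_1}\cdots s_{\alpha_{n-1}}s_\beta s_{\alpha_{n-1}}\cdots s_{\alpha_1}$ (the reflection in $2(\alpha_1+\dots+\alpha_{n-1})+\beta$). $\Sigma_w^-=\{\gamma\in\Sigma^+:w(\gamma)<0\}$, $U_w^-=\prod_{\gamma\in\Sigma_w^-}U_\gamma$, $U_{w,m}^-=U_w^-\cap H_m$. *)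

(* Defs.v *)
From HB Require Import structures.
From mathcomp Require Import all_boot all_order fingroup perm all_algebra.
From mathcomp Require Import all_classical all_reals all_analysis.
From mathcomp Require Import complex.

Set Implicit Arguments.
Unset Strict Implicit.
Unset Printing Implicit Defensive.

Import Order.TTheory GRing.Theory Num.Theory.

Local Open Scope classical_set_scope.
Local Open Scope ring_scope.

(* A p-adic field: a field of characteristic 0, complete for a normalized
   discrete valuation with finite residue field, with the valuation topology.
   The value of [pval] at 0 is irrelevant. *)
HB.mixin Record isPadicField F & GRing.Field F & Uniform F := {
  pval : F -> int;
  pvalM : forall x y : F, x != 0 -> y != 0 -> pval (x * y) = pval x + pval y;
  pvalD : forall x y : F, x != 0 -> y != 0 -> x + y != 0 ->
    Num.min (pval x) (pval y) <= pval (x + y);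
  pval_normalized : exists2 x : F, x != 0 & pval x = 1;
  padic_entourageE : forall A : set (F * F), entourage A <->
    exists k : int, forall x y : F, (x - y = 0 \/ k <= pval (x - y)) -> A (x, y);
  padic_complete : forall G : set_system F, ProperFilter G -> cauchy G ->
    exists l : F, G --> l;
  padic_residue_finite :
    finite_set [set [set y : F | y - x = 0 \/ 1 <= pval (y - x)] |
                 x in [set x : F | x = 0 \/ 0 <= pval x]];
  padic_pchar0 : [pchar F] =i pred0 }.

#[short(type="padicFieldType")]
HB.structure Definition PadicField :=
  {F of GRing.Field F & Uniform F & isPadicField F}.

(* [Pointed] cannot be a superclass of [PadicField]: HB would then require a join
   of [Pointed] and [Algebra.BaseAddMagma] declared before the normed structures
   of the library. *)
#[non_forgetful_inheritance]
HB.instance Definition _ (F : padicFieldType) := isPointed.Build F 0.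

Section PadicFieldDefs.
Variable F : padicFieldType.

(* The fractional ideal P^k; in particular [pideal F 0] is O. *)
Definition pideal (k : int) : set F := [set x | x = 0 \/ k <= pval x].

Definition uniformizer (x : F) : Prop := x != 0 /\ pval x = 1.

(* [psi_trivial_O] makes [psi] locally constant, hence continuous. *)
Record additive_character_of_conductor_O (R : rcfType) (psi : F -> R[i])
    : Prop := {
  psi_neq0 : forall x, psi x != 0;
  psiD : forall x y, psi (x + y) = psi x * psi y;
  psi_trivial_O : forall x, pideal 0 x -> psi x = 1;
  psi_conductor : exists2 x, pideal (-1) x & psi x != 1 }.

End PadicFieldDefs.

Section Symplectic.
Variables (F : padicFieldType) (n : nat).
Local Notation M := 'M[F]_(n + n).

Definition Jn : 'M[F]_n := \matrix_(i, j) (j == rev_ord i)%:R.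

Definition symp_form : M := block_mx 0 Jn (- Jn) 0.

Definition Sp : set M := [set g | g^T *m symp_form *m g = symp_form].

Definition Sp_center : set M :=
  [set z | Sp z /\ forall g, Sp g -> z *m g = g *m z].

Definition Uni : set M := [set u | [/\ Sp u, forall i, u i i = 1 &
  forall i j : 'I_(n + n), (j < i)%N -> u i j = 0]].

Definition Tor : set M := [set t | exists2 a : 'rV[F]_n,
  (forall i, a 0 i != 0) &
  t = diag_mx (row_mx a (\row_i (a 0 (rev_ord i))^-1))].

Definition Bor : set M := [set g | exists t u, [/\ Tor t, Uni u & g = t *m u]].

(* The sum of the entries (i, i+1) for 1 <= i <= n (with 1-based indices). *)
Definition superdiag (g : M) : F :=
  \sum_(i < n) g (lshift n i) (ordS (lshift n i)).

(** Weyl group: its elements are the cosets of T in N(T). *)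

Definition NTor : set M :=
  [set g | Sp g /\ forall t, Tor t <-> Tor (g *m t *m invmx g)].

Definition Tcoset (g : M) : set M := [set g *m t | t in Tor].

Definition weyl : set (set M) := [set Tcoset g | g in NTor].

(* Representatives of the simple reflections: [simple_refl i] represents
   s_{alpha_{i+1}} if i < n - 1 and s_beta if i = n - 1. *)
Definition simple_refl (i : 'I_n) : M :=
  let p := lshift n i in let q := ordS p in
  if (i.+1 < n)%N
  then perm_mx (tperm p q) *m perm_mx (tperm (rev_ord p) (rev_ord q))
  else \matrix_(j, k)
    (if (j == p) && (k == q) then 1
     else if (j == q) && (k == p) then -1
     else ((j == k) && (j != p) && (j != q))%:R).

Definition word_mx (s : seq 'I_n) : M :=
  \big[mulmx/1%:M]_(i <- s) simple_refl i.

Definition weyl_word (s : seq 'I_n) : set M := Tcoset (word_mx s).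

Definition weyl_length (w : set M) : nat :=
  xget 0%N [set k | (exists2 s, size s = k & weyl_word s = w) /\
                    forall s, weyl_word s = w -> (k <= size s)%N].

Definition reduced_word (w : set M) (s : seq 'I_n) : Prop :=
  weyl_word s = w /\ size s = weyl_length w.

Definition bruhat_le (w' w : set M) : Prop :=
  exists s s', [/\ reduced_word w s, subseq s' s & w' = weyl_word s'].

Definition bruhat_lt (w' w : set M) : Prop := bruhat_le w' w /\ w' <> w.

Definition w0 : set M :=
  weyl_word (enum 'I_n ++ behead (rev (enum 'I_n))).

(** Roots: [g : {ffun 'I_n -> int}] stands for the rational character
    t |-> \prod_i a_i ^ (g i) of T. *)

Local Notation chi := {ffun 'I_n -> int}.

Definition char_eval (g : chi) (t : M) : F :=
  \prod_(i < n) t (lshift n i) (lshift n i) ^ g i.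

Definition simple_root (i : 'I_n) : chi :=
  [ffun j : 'I_n => if (i.+1 < n)%N
                    then (j == i)%:Z - (j == i.+1 :> nat)%:Z
                    else 2 * (j == i)%:Z].

Definition sp_lie : set M :=
  [set X | X^T *m symp_form + symp_form *m X = 0].

Definition root_space (g : chi) : set M := [set X | sp_lie X /\
  forall t, Tor t -> t *m X *m invmx t = char_eval g t *: X].

Definition sp_root : set chi :=
  [set g | g != 0 /\ exists2 X, root_space g X & X != 0].

Definition pos_root : set chi :=
  [set g | sp_root g /\
           exists c : 'I_n -> nat, g = \sum_(i < n) simple_root i *+ c i].

(* Every X in a root space of sp_2n satisfies X ^ 2 = 0, so exp X = 1 + X. *)
Definition root_subgroup (g : chi) : set M :=
  [set 1%:M + X | X in root_space g].

(* d = w(g), i.e. d(t) = g(w^-1 t w) for all t. *)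
Definition weyl_act (w : set M) (g d : chi) : Prop :=
  forall x t, w x -> Tor t -> char_eval d t = char_eval g (invmx x *m t *m x).

Definition inv_roots (w : set M) : set chi :=
  [set g | pos_root g /\ exists2 d, pos_root d & weyl_act w g (- d)].

(* The product set of the root subgroups, for some enumeration of [inv_roots w];
   the product set does not depend on the enumeration. *)
Definition Uminus (w : set M) : set M :=
  [set u | exists (s : seq chi) (x : chi -> M),
    [/\ uniq s, [set` s] = inv_roots w,
        forall g, inv_roots w g -> root_subgroup g (x g) &
        u = \big[mulmx/1%:M]_(g <- s) x g]].

Definition bruhat_cell (x : M) : set M :=
  [set g | exists b1 b2, [/\ Bor b1, Bor b2 & g = b1 *m x *m b2]].

Definition Kgrp (m : nat) : set M :=
  [set k | Sp k /\ forall i j, pideal m%:Z ((k - 1%:M) i j)].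

Section Howe.
Variables (R : realType) (varpi : F) (psi : F -> R[i]).

Definition psiU (u : M) : R[i] := psi (superdiag u).

Definition tau (m : nat) (k : M) : R[i] :=
  psi (varpi ^ (- (2 * m)%N%:Z) * superdiag k).

(* With 0-based i the exponent of the i-th entry is (2i + 1 - 2n)m. *)
Definition dmx (m : nat) : M :=
  diag_mx (\row_(i < n + n)
             varpi ^ (((2 * i + 1)%N%:Z - (2 * n)%N%:Z) * m%:Z)).

Definition Hgrp (m : nat) : set M :=
  [set dmx m *m k *m invmx (dmx m) | k in Kgrp m].

Definition psiH (m : nat) (h : M) : R[i] :=
  tau m (invmx (dmx m) *m h *m dmx m).

Definition Um (m : nat) : set M := Uni `&` Hgrp m.

Definition Uminus_m (w : set M) (m : nat) : set M := Uminus w `&` Hgrp m.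

Definition borel_mx := g_sigma_algebraType (@open M).

(* A (left) Haar measure on a closed subgroup G of GL_2n(F), viewed as a Borel
   measure on the space of matrices concentrated on G. *)
Record haar_measure (G : set M) (mu : {measure set borel_mx -> \bar R})
    : Prop := {
  haar_conc : mu (~` G) = 0%E;
  haar_invariant : forall (g : M) (A : set borel_mx), G g -> measurable A ->
    mu [set g *m x | x in A] = mu A;
  haar_compact : forall K : set M, compact K -> K `<=` G -> (mu K < +oo)%E;
  haar_open : forall O : set M, open O -> O `&` G !=set0 ->
    (0 < mu (O `&` G))%E }.

(* The integral over A of a vector-valued function taking finitely many values
   on A: the sum of mu(A /\ f = x) x over these values. A locally constant
   function on a compact set is of this kind. *)
Definition vintegral (mu : {measure set borel_mx -> \bar R})
    (V : lmodType R[i]) (A : set M) (f : M -> V) : V :=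
  \sum_(x \in f @` A) (fine (mu (A `&` f @^-1` [set x])))%:C%C *: x.

Section Representation.
Variables (V : lmodType R[i]) (rho : M -> {linear V -> V}).

Record representation : Prop := {
  rep1 : forall v, rho 1%:M v = v;
  repM : forall g h, Sp g -> Sp h -> forall v, rho (g *m h) v = rho g (rho h v) }.

Definition smooth_rep : Prop := forall v, exists2 O : set M, open O &
  [set g | Sp g /\ rho g v = v] = Sp `&` O.

Record subrepresentation (S : set V) : Prop := {
  subrep0 : S 0;
  subrepD : forall x y, S x -> S y -> S (x + y);
  subrepZ : forall c x, S x -> S (c *: x);
  subrep_stable : forall g x, Sp g -> S x -> S (rho g x) }.

Definition irreducible_rep : Prop := (exists v : V, v != 0) /\
  forall S, subrepresentation S -> S = [set 0] \/ S = setT.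

Definition central_character (omega : M -> R[i]) : Prop :=
  forall z v, Sp_center z -> rho z v = omega z *: v.

Definition whittaker_functional (lambda : {scalar V}) : Prop :=
  (exists v, lambda v != 0) /\
  forall u v, Uni u -> lambda (rho u v) = psiU u * lambda v.

Definition whittaker (lambda : {scalar V}) (v : V) (g : M) : R[i] :=
  lambda (rho g v).

Definition howe_vector (mu : {measure set borel_mx -> \bar R})
    (m : nat) (v : V) : V :=
  ((fine (mu (Um m)))^-1)%:C%C *:
    vintegral mu (Um m) (fun u => (psiH m u)^-1 *: rho u v).

End Representation.
End Howe.
End Symplectic.

(* Main.v *)
(** For u in U, the value W_{v_m}(t w u) is an average over x in U_m of the values
    psi_U(x)^-1 W_{v_k}(t w u x), for any k with 3k <= m. Peel the letters of a reduced word of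
    w off from the right. As long as the entries of u at the simple roots met on
    the way are small, u stays in (U cap w^-1 U w) U_m, and the value is determined
    by the values on T w. At the first large entry r, the SL_2 identity
    s x_alpha(r) = b x_{-alpha}(1/r) replaces w u by an element of a smaller Bruhat
    cell times a conjugate by elements of H_m of the small root element
    x_{-alpha}(1/r). Such conjugates lie in a lattice of matrices that is closed
    under multiplication and has diagonal in 1 + P, so that Gaussian elimination
    factors them as an element of B times a lower unipotent element of H_k, which
    fixes the Howe vector v_k. Hence the value comes from smaller cells, and the
    result follows by induction on subwords.

    If mu(U_m) is infinite, the normalizing factor vol(U_m)^-1 is 0 by convention
    and both Howe vectors vanish. If it is finite, positivity of mu on open
    subgroups makes all the relevant indices finite, and the integrals become sums
    over cosets. *)
From HB Require Import structures.
From mathcomp Require Import all_boot all_order fingroup perm all_algebra.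
From mathcomp Require Import all_classical all_reals all_analysis.
From mathcomp Require Import complex zify ring.
Require Import Defs.

Set Implicit Arguments.
Unset Strict Implicit.
Unset Printing Implicit Defensive.

Import Order.TTheory GRing.Theory Num.Theory.

Local Open Scope classical_set_scope.
Local Open Scope ring_scope.

Section PadicIdeals.
Variable F : padicFieldType.
Implicit Types (x y : F) (k l : int).

Lemma pval1 : pval (1 : F) = 0.
Proof.
have := pvalM _ _ (oner_neq0 F) (oner_neq0 F); rewrite mulr1.
by move: (pval _) => y; lia.
Qed.

Lemma pvalN1 : pval (-1 : F) = 0.
Proof.
have n1 : (-1 : F) != 0 by rewrite oppr_eq0 oner_neq0.
have := pvalM _ _ n1 n1; rewrite mulrNN mulr1 pval1.
by move: (pval _) => y; lia.
Qed.

Lemma pvalV x : x != 0 -> pval x^-1 = - pval x.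
Proof.
move=> x0; have := pvalM _ _ x0 (invr_neq0 x0); rewrite mulfV // pval1.
by move: (pval _) (pval _) => y z; lia.
Qed.

Lemma pideal_le k l x : l <= k -> pideal k x -> pideal l x.
Proof. by move=> lk [->|kx]; [left|right; apply: le_trans kx]. Qed.

Lemma pidealM k l x y : pideal k x -> pideal l y -> pideal (k + l) (x * y).
Proof.
have [->|x0] := eqVneq x 0; first by rewrite mul0r; left.
have [->|y0] := eqVneq y 0; first by rewrite mulr0; left.
move=> [/eqP|kx]; first by rewrite (negPf x0).
move=> [/eqP|ly]; first by rewrite (negPf y0).
by right; rewrite pvalM // lerD.
Qed.

Lemma pideal_signM k (b : bool) x : pideal k ((-1) ^+ b * x) <-> pideal k x.
Proof.
have sign y : pideal k y -> pideal k ((-1) ^+ b * y).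
  move=> ky; rewrite -[k]add0r; apply: pidealM ky; right.
  by case: b; rewrite ?expr1 ?expr0 ?pvalN1 ?pval1.
by split=> [/sign|]; [rewrite signrMK|apply: sign].
Qed.

Lemma pidealN k x : pideal k (- x) <-> pideal k x.
Proof. by rewrite -mulN1r -[-1]expr1; apply: (pideal_signM k true). Qed.

Lemma pidealD k x y : pideal k x -> pideal k y -> pideal k (x + y).
Proof.
have [->|x0] := eqVneq x 0; first by rewrite add0r.
have [->|y0] := eqVneq y 0; first by rewrite addr0.
have [->|xy0] := eqVneq (x + y) 0; first by left.
move=> [/eqP|kx]; first by rewrite (negPf x0).
move=> [/eqP|ky]; first by rewrite (negPf y0).
by right; apply: le_trans (pvalD _ _ x0 y0 xy0); rewrite le_min kx ky.
Qed.

Lemma pidealB k x y : pideal k x -> pideal k y -> pideal k (x - y).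
Proof. by move=> kx ky; apply: pidealD kx _; apply/pidealN. Qed.

Lemma pideal_sum (I : Type) (r : seq I) (P : pred I) (G : I -> F) k :
  (forall i, P i -> pideal k (G i)) -> pideal k (\sum_(i <- r | P i) G i).
Proof. by move=> kG; elim/big_rec: _ => [|i x /kG]; [left|apply: pidealD]. Qed.

Lemma notin_pidealV k x : ~ pideal k x -> pideal (1 - k) x^-1.
Proof.
move=> nk; have [x0|x0] := eqVneq x 0; first by case: nk; left.
right; rewrite pvalV //.
by case: (leP k (pval x)) => [kx|]; [case: nk; right|lia].
Qed.

Lemma one_plus_pideal1_neq0 x : pideal 1 x -> 1 + x != 0.
Proof.
move=> [->|x1]; first by rewrite addr0 oner_neq0.
apply: contraPneq x1 => /eqP; rewrite addrC addr_eq0 => /eqP ->.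
by rewrite pvalN1.
Qed.

Lemma one_plus_pideal1V x : pideal 1 x -> pideal 0 (1 + x)^-1.
Proof.
move=> x1; have u := one_plus_pideal1_neq0 x1.
right; rewrite pvalV //; case: (leP (pval (1 + x)) 0) => [|pos]; first by lia.
have : pideal 1 ((1 + x) - x) by apply: pidealB x1; right; lia.
by rewrite addrK => -[/eqP|]; rewrite ?oner_eq0 ?pval1.
Qed.

Lemma pideal_all_eq0 x : (forall k, pideal k x) -> x = 0.
Proof. by move=> h; have [//|] := h (pval x + 1); lia. Qed.

Lemma pideal_uniformizer_expz (varpi : F) k :
  uniformizer varpi -> pideal k (varpi ^ k).
Proof.
move=> [x0 vx]; right.
have vX (j : nat) : pval (varpi ^+ j) = j%:Z.
  elim: j => [|j IH]; first by rewrite expr0 pval1.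
  by rewrite exprS pvalM ?expf_neq0 // IH vx; lia.
by case: k => j; [rewrite -exprnP vX|rewrite NegzE -exprnN pvalV ?expf_neq0 // vX].
Qed.

Lemma uniformizer_expz_inj (varpi : F) :
  uniformizer varpi -> injective (fun k : int => varpi ^ k).
Proof.
move=> hvarpi; have [v0 _] := hvarpi.
suff le i j : varpi ^ i = varpi ^ j -> i <= j.
  by move=> i j e; apply/eqP; rewrite eq_le !le.
move=> e; have := pideal_uniformizer_expz (i - j) hvarpi.
rewrite expfzDr // e -expfzDr // subrr expr0z => -[/eqP|].
  by rewrite oner_eq0.
by rewrite pval1; lia.
Qed.

End PadicIdeals.

Section SupportedMatrices.
Variables (R : nzRingType) (N : nat).
Implicit Types (e : rel 'I_N) (A B : 'M[R]_N).

Definition supported e A := forall a b, A a b != 0 -> e a b.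

Definition unisupported e A := supported e A /\ forall a, A a a = 1.

Lemma supportedP e A :
  supported e A <-> forall a b, ~~ e a b -> A a b = 0.
Proof.
split=> [sA a b|sA a b]; first by apply: contraNeq => /sA.
by apply: contra_neqT => /sA.
Qed.

Lemma supported_sub e e' A : subrel e e' -> supported e A -> supported e' A.
Proof. by move=> ee' sA a b /sA/ee'. Qed.

Lemma supported_tr e A : supported e A -> supported (fun a b => e b a) A^T.
Proof. by move=> sA a b; rewrite mxE => /sA. Qed.

Lemma supported1 e : reflexive e -> supported e 1%:M.
Proof.
by move=> re a b; rewrite mxE; have [->//|_] := eqVneq a b; rewrite eqxx.
Qed.

Lemma supportedM e A B : transitive e ->
  supported e A -> supported e B -> supported e (A *m B).
Proof.
move=> te sA sB a b; apply: contra_neqT => nab; rewrite mxE big1 // => c _.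
apply/eqP; apply: contraNT nab => nz; apply: (te c).
  by apply: sA; apply: contraNneq nz => ->; rewrite mul0r.
by apply: sB; apply: contraNneq nz => ->; rewrite mulr0.
Qed.

Lemma supportedM_diag e A B a : antisymmetric e ->
  supported e A -> supported e B -> (A *m B) a a = A a a * B a a.
Proof.
move=> ae sA sB; rewrite mxE (bigD1 a) //= big1 ?addr0 // => c ca.
apply/eqP; apply: contraNT ca => nz; apply/eqP/ae/andP; split.
  by apply: sB; apply: contraNneq nz => ->; rewrite mulr0.
by apply: sA; apply: contraNneq nz => ->; rewrite mul0r.
Qed.

Lemma unisupported1 e : reflexive e -> unisupported e 1%:M.
Proof. by move=> re; split=> [|a]; [apply: supported1|rewrite mxE eqxx]. Qed.

Lemma unisupportedM e A B : transitive e -> antisymmetric e ->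
  unisupported e A -> unisupported e B -> unisupported e (A *m B).
Proof.
move=> te ae [sA dA] [sB dB]; split=> [|a]; first exact: supportedM.
by rewrite (supportedM_diag a ae) // dA dB mulr1.
Qed.

Lemma unisupported_tr e A :
  unisupported e A -> unisupported (fun a b => e b a) A^T.
Proof. by move=> [sA dA]; split=> [|a]; [apply: supported_tr|rewrite mxE]. Qed.

Lemma unisupported_inter1 e A : antisymmetric e ->
  unisupported e A -> supported (fun a b => e b a) A -> A = 1%:M.
Proof.
move=> ae [sA dA] sA'; apply/matrixP => a b; rewrite mxE.
have [->|ab] := eqVneq a b; first exact: dA.
by apply: contra_neq_eq ab => nz; apply: ae; rewrite sA ?sA'.
Qed.

Lemma supported_upperM A B :
  supported <=%O A -> supported <=%O B -> supported <=%O (A *m B).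
Proof. by move=> uA uB; apply: supportedM uA uB; apply: le_trans. Qed.

Lemma supported_lowerM A B :
  supported >=%O A -> supported >=%O B -> supported >=%O (A *m B).
Proof. by move=> uA uB; apply: supportedM uA uB; apply: ge_trans. Qed.

Lemma unisupported_upper_lower1 P Q : unisupported <=%O P -> supported >=%O Q ->
  Q *m P = 1%:M -> P = 1%:M.
Proof.
move=> uP /supportedP lQ eQP; have [_ dP] := uP.
apply: (unisupported_inter1 (@le_anti _ _) uP).
apply/supportedP => a b; rewrite -ltNge.
have [k ak] := ubnP (a : nat); elim: k a ak b => // k IH a ak b ab.
have eQ c : (a <= c)%O -> Q a a * P a c = (a == c)%:R.
  move=> ac; have := congr1 (fun X : 'M[R]_N => X a c) eQP.
  rewrite !mxE (bigD1 a) //= big1 ?addr0 // => j; rewrite neq_lt.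
  move=> /orP[ja|aj]; last by rewrite lQ ?mul0r //= -ltNge.
  by rewrite IH ?mulr0 //; [apply: leq_trans ja _|apply: lt_le_trans ac].
have := eQ a (lexx a); rewrite dP mulr1 eqxx => Qaa.
by have := eQ b (ltW ab); rewrite Qaa mul1r lt_eqF.
Qed.

Lemma supported_eqE A :
  supported <=%O A -> supported >=%O A -> supported eq_op A.
Proof.
move=> uA lA a b nz; apply/eqP/le_anti/andP.
by split; [apply: uA|apply: lA].
Qed.

Lemma supported_diag_mx (d : 'rV[R]_N) : supported eq_op (diag_mx d).
Proof. by move=> a b; rewrite mxE; case: (a == b); rewrite ?mulr0n ?eqxx. Qed.

Lemma supported_eq_diag_mx A : supported eq_op A -> A = diag_mx (\row_a A a a).
Proof.
move=> /supportedP dA; apply/matrixP => a b; rewrite !mxE.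
by have [->//|/dA] := eqVneq a b.
Qed.

Lemma supported_eq_upper A : supported eq_op A -> supported <=%O A.
Proof. by apply: supported_sub => a b /eqP ->; apply: lexx. Qed.

End SupportedMatrices.

Lemma supported_block_upper (R : nzRingType) m n (A : 'M[R]_m)
    (B : 'M[R]_(m, n)) (D : 'M[R]_n) : supported <=%O A -> supported <=%O D ->
  supported <=%O (block_mx A B 0 D).
Proof.
move=> uA uD a b; case: (split_ordP a) => a' ->; case: (split_ordP b) => b' ->;
  rewrite ?(block_mxEul, block_mxEur, block_mxEdl, block_mxEdr) !leEord /=.
- exact: uA.
- by move=> _; apply: leq_trans (ltnW (ltn_ord a')) (leq_addr _ _).
- by rewrite mxE eqxx.
- by rewrite leq_add2l; apply: uD.
Qed.

Section Lattices.
Variable F : padicFieldType.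

Definition lattice m n (f : 'I_m -> 'I_n -> int) : set 'M[F]_(m, n) :=
  [set A | forall a b, pideal (f a b) (A a b)].

Lemma latticeD m n (f : 'I_m -> 'I_n -> int) A B :
  lattice f A -> lattice f B -> lattice f (A + B).
Proof. by move=> fA fB a b; rewrite mxE; apply: pidealD. Qed.

Lemma lattice_le m n (f f' : 'I_m -> 'I_n -> int) A :
  (forall a b, f' a b <= f a b) -> lattice f A -> lattice f' A.
Proof. by move=> ff' fA a b; apply: pideal_le (fA a b). Qed.

Lemma lattice_tr m n (f : 'I_m -> 'I_n -> int) A :
  lattice f A -> lattice (fun a b => f b a) A^T.
Proof. by move=> fA a b; rewrite mxE. Qed.

Lemma latticeM m n p (f : 'I_m -> 'I_n -> int) (g : 'I_n -> 'I_p -> int) h A B :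
  (forall a c b, h a b <= f a c + g c b) ->
  lattice f A -> lattice g B -> lattice h (A *m B).
Proof.
move=> fgh fA gB a b; rewrite mxE; apply: pideal_sum => c _.
exact: pideal_le (fgh a c b) (pidealM _ _).
Qed.

Lemma lattice_block m1 m2 n1 n2 (f : 'I_(m1 + m2) -> 'I_(n1 + n2) -> int)
    (A : 'M[F]_(m1, n1)) (B : 'M[F]_(m1, n2)) (C : 'M[F]_(m2, n1)) (D : 'M[F]_(m2, n2)) :
  lattice f (block_mx A B C D) <->
  [/\ lattice (fun a b => f (lshift m2 a) (lshift n2 b)) A,
      lattice (fun a b => f (lshift m2 a) (rshift n1 b)) B,
      lattice (fun a b => f (rshift m1 a) (lshift n2 b)) C &
      lattice (fun a b => f (rshift m1 a) (rshift n1 b)) D].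
Proof.
split=> [fA|[fA fB fC fD] a b].
  split=> a b; [move: (fA (lshift _ a) (lshift _ b))|
    move: (fA (lshift _ a) (rshift _ b))|move: (fA (rshift _ a) (lshift _ b))|
    move: (fA (rshift _ a) (rshift _ b))];
    by rewrite ?(block_mxEul, block_mxEur, block_mxEdl, block_mxEdr).
by case: (split_ordP a) => a' ->; case: (split_ordP b) => b' ->;
  rewrite ?(block_mxEul, block_mxEur, block_mxEdl, block_mxEdr).
Qed.

Lemma lattice_bounded m n (A : 'M[F]_(m, n)) :
  exists2 c : int, c <= 0 & lattice (fun _ _ => c) A.
Proof.
exists (- \sum_a \sum_b `|pval (A a b)|) => [|a b].
  by rewrite oppr_le0 sumr_ge0 // => a _; apply: sumr_ge0.
right; apply: le_trans (_ : - `|pval (A a b)| <= _); last by lia.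
rewrite lerN2 (bigD1 a) //= (bigD1 b) //= -addrA lerDl.
by apply: addr_ge0; apply: sumr_ge0 => // c _; apply: sumr_ge0.
Qed.

Lemma lattice_all_eq0 m n (A : 'M[F]_(m, n)) :
  (forall k : int, lattice (fun _ _ => k) A) -> A = 0.
Proof.
by move=> h; apply/matrixP => a b; rewrite mxE; apply: pideal_all_eq0 => k; apply: h.
Qed.

Section OnePlus.
Variable N : nat.
Implicit Types (f : 'I_N -> 'I_N -> int) (A B : 'M[F]_N).

Definition subadditive f := forall a c b, f a b <= f a c + f c b.

Definition one_plus f : set 'M[F]_N := [set A | lattice f (A - 1%:M)].

Lemma one_plus1 f : one_plus f 1%:M.
Proof. by move=> a b; rewrite subrr mxE; left. Qed.

Lemma one_plusM f A B : subadditive f ->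
  one_plus f A -> one_plus f B -> one_plus f (A *m B).
Proof.
rewrite /one_plus /= => ff fA fB.
have -> : A *m B - 1%:M = (A - 1%:M) *m (B - 1%:M) + ((A - 1%:M) + (B - 1%:M)).
  rewrite mulmxBl mul1mx mulmxBr mulmx1.
  by rewrite [_ + (B - _)]addrC addrA subrK addrA subrK.
by apply: latticeD; [apply: latticeM fA fB|apply: latticeD].
Qed.

Lemma one_plus_le f f' A : (forall a b, f' a b <= f a b) ->
  one_plus f A -> one_plus f' A.
Proof. exact: lattice_le. Qed.

Lemma one_plus_tr f A : one_plus f A -> one_plus (fun a b => f b a) A^T.
Proof.
by rewrite /one_plus /= -[in _^T - _](trmx1 _ N) -linearB; apply: lattice_tr.
Qed.

Lemma one_plus_unisupported e f f' A : unisupported e A ->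
  (forall a b, a != b -> e a b -> f' a b <= f a b) ->
  one_plus f A -> one_plus f' A.
Proof.
move=> [/supportedP sA dA] ff' fA a b; have := fA a b; rewrite !mxE.
have [->|ab] := eqVneq a b; first by rewrite dA subrr => _; left.
rewrite subr0; have [eab|/sA ->] := boolP (e a b); last by left.
exact/pideal_le/ff'.
Qed.

End OnePlus.

Lemma one_plus_block m n (f : 'I_(m + n) -> 'I_(m + n) -> int)
    (A : 'M[F]_m) (B : 'M[F]_(m, n)) (C : 'M[F]_(n, m)) (D : 'M[F]_n) :
  one_plus f (block_mx A B C D) <->
  [/\ one_plus (fun a b => f (lshift n a) (lshift n b)) A,
      lattice (fun a b => f (lshift n a) (rshift m b)) B,
      lattice (fun a b => f (rshift m a) (lshift n b)) C &
      one_plus (fun a b => f (rshift m a) (rshift m b)) D].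
Proof.
rewrite /one_plus /= scalar_mx_block opp_block_mx add_block_mx !subr0.
exact: lattice_block.
Qed.

(* Gaussian elimination of the last index: the pivot is a unit because the
   diagonal of A is congruent to 1. *)
Lemma one_plus_upper_lower N (f : 'I_N -> 'I_N -> int) A :
  subadditive f -> (forall a, 1 <= f a a) -> one_plus f A ->
  exists U L, [/\ A = U *m L, unisupported <=%O U /\ one_plus f U &
    supported >=%O L /\ one_plus f L].
Proof.
elim: N f A => [|N IH]; rewrite -?[N.+1]addn1 => f A ff f1.
  exists 1%:M, 1%:M; split; first by apply/matrixP => -[].
    by split; [apply: unisupported1; exact: lexx|exact: one_plus1].
  by split; [apply: supported1; exact: lexx|exact: one_plus1].
rewrite -[A]submxK; set A' := ulsubmx A; set b := ursubmx A.
set c := dlsubmx A; set d := drsubmx A.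
move=> /one_plus_block[fA' fb fc fd].
have d1 : pideal 1 (d 0 0 - 1).
  by have := fd 0 0; rewrite !mxE eqxx mulr1n; apply/pideal_le/f1.
have d0 : d 0 0 != 0 by have := one_plus_pideal1_neq0 d1; rewrite subrKC.
have dV : pideal 0 (d 0 0)^-1 by have := one_plus_pideal1V d1; rewrite subrKC.
pose b' := (d 0 0)^-1 *: b.
have fb' : lattice (fun a e => f (lshift 1 a) (rshift N e)) b'.
  by move=> a e; rewrite mxE -[f _ _]add0r; apply: pidealM.
have [|||U [L [eUL [[sU dU] fU] [sL fL]]]] :=
  IH (fun a e => f (lshift 1 a) (lshift 1 e)) (A' - b' *m c).
- by move=> a e e'; apply: ff.
- by move=> a; apply: f1.
- rewrite /one_plus /= addrAC -mulNmx; apply: latticeD fA' _.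
  apply: (latticeM _ _ fc) => [a e e'|a e]; first exact: ff.
  by rewrite mxE; apply/pidealN.
pose Uz := block_mx U b' 0 1%:M; pose Lz := block_mx L 0 c d.
have unip (X : 'M[F]_1) : supported <=%O X by move=> a e _; rewrite !ord1.
exists Uz, Lz; split.
- rewrite mulmx_block mulmx0 !mul0mx !mul1mx !add0r -eUL subrK.
  rewrite [d]mx11_scalar mul_mx_scalar scalerA divff // scale1r.
  by rewrite -mx11_scalar.
- split; [split|].
  + exact: supported_block_upper.
  + move=> a; case: (split_ordP a) => a' ->.
      by rewrite block_mxEul dU.
    by rewrite block_mxEdr mxE eqxx.
  + apply/one_plus_block; split=> //; last exact: one_plus1.
    by move=> a e; rewrite mxE; left.
- split.
    rewrite -[Lz]trmxK tr_block_mx trmx0; apply: supported_tr.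
    exact: supported_block_upper (supported_tr sL) _.
  by apply/one_plus_block; split=> // a e; rewrite mxE; left.
Qed.

End Lattices.

Section MatrixGroups.
Variables (R : comUnitRingType) (N : nat).
Local Notation M := 'M[R]_N.
Implicit Types (g h x : M).

Record is_mxgroup (G : set M) : Prop := IsMxGroup {
  is_mxgroup_unit : forall g, G g -> g \in unitmx;
  is_mxgroup1 : G 1%:M;
  is_mxgroupM : forall g h, G g -> G h -> G (g *m h);
  is_mxgroupV : forall g, G g -> G (invmx g) }.

Structure mxgroup := MxGroup {
  mxgroup_set :> M -> Prop;
  mxgroupP : is_mxgroup mxgroup_set }.

Section Theory.
Variable G : mxgroup.

Lemma mxg_unit g : G g -> g \in unitmx.
Proof. exact: is_mxgroup_unit (mxgroupP G) _. Qed.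

Lemma mxg1 : G 1%:M.
Proof. exact: is_mxgroup1 (mxgroupP G). Qed.

Lemma mxgM g h : G g -> G h -> G (g *m h).
Proof. exact: is_mxgroupM (mxgroupP G) _ _. Qed.

Lemma mxgV g : G g -> G (invmx g).
Proof. exact: is_mxgroupV (mxgroupP G) _. Qed.

End Theory.

Lemma invmxM g h : g \in unitmx -> h \in unitmx ->
  invmx (g *m h) = invmx h *m invmx g.
Proof.
move=> ug uh; have ugh : g *m h \in unitmx by rewrite unitmx_mul ug.
apply: (can_inj (mulKmx ugh)).
by rewrite mulmxV // !mulmxA mulmxK // mulmxV.
Qed.

Definition opposite (G : set M) : set M := [set g | G g^T].

Lemma opposite_is_mxgroup (G : mxgroup) : is_mxgroup (opposite G).
Proof.
rewrite /opposite; split=> /= [g /mxg_unit||g h gG hG|g gG].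
- by rewrite unitmx_tr.
- by rewrite trmx1; apply: mxg1.
- by rewrite trmx_mul; apply: mxgM.
- by rewrite trmx_inv; apply: mxgV.
Qed.
Canonical opposite_mxgroup G := MxGroup (opposite_is_mxgroup G).

Lemma setI_is_mxgroup (G H : mxgroup) : is_mxgroup (G `&` H).
Proof.
split=> [g [/mxg_unit]||g h [gG gH] [hG hH]|g [gG gH]] //.
- by split; apply: mxg1.
- by split; apply: mxgM.
- by split; apply: mxgV.
Qed.
Canonical setI_mxgroup G H := MxGroup (setI_is_mxgroup G H).

Lemma mxconj1 x : x \in unitmx -> x *m 1%:M *m invmx x = 1%:M.
Proof. by move=> ux; rewrite mulmx1 mulmxV. Qed.

Lemma mxconjM x g h : x \in unitmx ->
  x *m (g *m h) *m invmx x = (x *m g *m invmx x) *m (x *m h *m invmx x).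
Proof. by move=> ux; rewrite !mulmxA mulmxKV. Qed.

Lemma mxconjK x g : x \in unitmx -> invmx x *m (x *m g *m invmx x) *m x = g.
Proof. by move=> ux; rewrite !mulmxA mulVmx // mul1mx mulmxKV. Qed.

Lemma mxconjVK x g : x \in unitmx -> x *m (invmx x *m g *m x) *m invmx x = g.
Proof. by move=> ux; rewrite !mulmxA mulmxV // mul1mx mulmxK. Qed.

End MatrixGroups.

Section SymplecticGroup.
Variables (F : padicFieldType) (n : nat).
Local Notation M := 'M[F]_(n + n).
Local Notation I := 'I_(n + n).
Implicit Types (g h A B : M) (a b c : I) (f : I -> I -> int).

Definition in_lower_half a : bool := (n <= a)%N.
Local Notation sgn a b := ((-1) ^+ (in_lower_half a (+) in_lower_half b)).

Lemma in_lower_half_rev a : in_lower_half (rev_ord a) = ~~ in_lower_half a.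
Proof. by rewrite /in_lower_half /=; have := ltn_ord a; lia. Qed.

Lemma rev_ord_neq a : (rev_ord a == a) = false.
Proof. by apply/eqP => /(congr1 val) /=; have := ltn_ord a; lia. Qed.

Lemma eq_rev_ord a b : (rev_ord a == b) = (a == rev_ord b).
Proof. by rewrite -(inj_eq rev_ord_inj) rev_ordK. Qed.

Lemma symp_formE a b :
  symp_form F n a b = (-1) ^+ in_lower_half a * (b == rev_ord a)%:R.
Proof.
rewrite /symp_form /in_lower_half -val_eqE /=; have := ltn_ord a.
case: (split_ordP a) => i -> _; case: (split_ordP b) => j ->;
  rewrite ?(block_mxEul, block_mxEur, block_mxEdl, block_mxEdr) !mxE -?val_eqE /=;
  have := ltn_ord i; have := ltn_ord j => hj hi.
- by rewrite [(_ == _)%N](_ : _ = false) ?mulr0 //; lia.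
- rewrite [(n <= i)%N](_ : _ = false) ?mul1r; last by lia.
  by congr ((nat_of_bool _)%:R); lia.
- rewrite leq_addr expr1 mulN1r; congr (- (nat_of_bool _)%:R); lia.
- by rewrite [(_ == _)%N](_ : _ = false) ?mulr0 ?oppr0 //; lia.
Qed.

(* The adjoint J^-1 A^T J of A for the symplectic form J. *)
Definition sp_adj A : M :=
  \matrix_(a, b) (sgn a b * A (rev_ord b) (rev_ord a)).

Lemma sp_adjM A B : sp_adj (A *m B) = sp_adj B *m sp_adj A.
Proof.
apply/matrixP => a b; rewrite !mxE mulr_sumr (reindex_inj rev_ord_inj) /=.
apply: eq_bigr => c _; rewrite !mxE.
have -> : sgn a b = sgn a c * sgn c b :> F.
  by rewrite -signr_addb addbA addbK.
ring.
Qed.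

Lemma sp_adjD A B : sp_adj (A + B) = sp_adj A + sp_adj B.
Proof. by apply/matrixP => a b; rewrite !mxE mulrDr. Qed.

Lemma sp_adj_tr A : sp_adj A^T = (sp_adj A)^T.
Proof. by apply/matrixP => a b; rewrite !mxE addbC. Qed.

Lemma sp_adj1 : sp_adj 1%:M = 1%:M.
Proof.
apply/matrixP => a b; rewrite !mxE (inj_eq rev_ord_inj) eq_sym.
by have [->|_] := eqVneq a b; rewrite ?addbb ?mul1r ?mulr0.
Qed.

Lemma supported_sp_adj (e : rel I) A : supported e A ->
  supported (fun a b => e (rev_ord b) (rev_ord a)) (sp_adj A).
Proof.
by move=> sA a b nz; apply: sA; apply: contraNneq nz; rewrite mxE => ->; rewrite mulr0.
Qed.

Lemma supported_upper_sp_adj A : supported <=%O A -> supported <=%O (sp_adj A).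
Proof.
move=> /supported_sp_adj; apply: supported_sub => a b; rewrite !leEord /=.
by have := ltn_ord a; have := ltn_ord b; lia.
Qed.

Lemma supported_lower_sp_adj A : supported >=%O A -> supported >=%O (sp_adj A).
Proof.
move=> lA; rewrite -[sp_adj A]trmxK -sp_adj_tr; apply: supported_tr.
by apply: supported_upper_sp_adj; apply: supported_tr lA.
Qed.

Lemma symp_form_mulE A a b :
  (symp_form F n *m A) a b = (-1) ^+ in_lower_half a * A (rev_ord a) b.
Proof.
rewrite mxE (bigD1 (rev_ord a)) //= symp_formE eqxx mulr1 big1 ?addr0 // => c ca.
by rewrite symp_formE (negPf ca) mulr0 mul0r.
Qed.

Lemma mul_symp_formE A a b :
  (A *m symp_form F n) a b = (-1) ^+ (~~ in_lower_half b) * A a (rev_ord b).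
Proof.
rewrite mxE (bigD1 (rev_ord b)) //= symp_formE rev_ordK eqxx in_lower_half_rev.
rewrite mulr1 mulrC big1 ?addr0 // => c cb.
by rewrite symp_formE [b == _]eq_sym eq_rev_ord (negPf cb) !mulr0.
Qed.

Lemma symp_form_sp_adj A : symp_form F n *m sp_adj A = A^T *m symp_form F n.
Proof.
apply/matrixP => a b; rewrite symp_form_mulE mul_symp_formE !mxE rev_ordK mulrA.
by rewrite -signr_addb in_lower_half_rev addbA addbN addbb.
Qed.

Lemma symp_form_inj : injective (mulmx (symp_form F n) : M -> M).
Proof.
move=> A B e; apply/matrixP => a b; have := congr1 (fun X : M => X (rev_ord a) b) e.
by rewrite !symp_form_mulE rev_ordK => /(can_inj (signrMK _)).
Qed.

Lemma SpP g : Sp g <-> sp_adj g *m g = 1%:M.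
Proof.
rewrite /Sp /= -symp_form_sp_adj -mulmxA -[X in _ = X](mulmx1 (symp_form F n)).
by split=> [/symp_form_inj|->].
Qed.

Lemma sp_lieP A : sp_lie A <-> sp_adj A = - A.
Proof.
rewrite /sp_lie /= -symp_form_sp_adj -mulmxDr.
split=> [e|->]; last by rewrite addNr mulmx0.
by apply/eqP; rewrite -addr_eq0; apply/eqP/symp_form_inj; rewrite e mulmx0.
Qed.

Lemma Sp_invE g : Sp g -> invmx g = sp_adj g.
Proof.
move=> /SpP e; have [_ ug] := mulmx1_unit e.
by rewrite -[LHS]mul1mx -e mulmxK.
Qed.

Lemma Sp_is_mxgroup : is_mxgroup (@Sp F n).
Proof.
split=> [g /SpP/mulmx1_unit[] //||g h /SpP gS /SpP hS|g gS].
- by apply/SpP; rewrite sp_adj1 mulmx1.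
- by apply/SpP; rewrite sp_adjM mulmxA -[_ *m g]mulmxA gS mulmx1.
- apply/SpP; rewrite Sp_invE // -sp_adjM.
  by move/SpP/mulmx1C: gS => ->; apply: sp_adj1.
Qed.
Canonical Sp_mxgroup := MxGroup Sp_is_mxgroup.

Lemma Sp_tr g : Sp g -> Sp g^T.
Proof. by move=> /SpP/mulmx1C e; apply/SpP; rewrite sp_adj_tr -trmx_mul e trmx1. Qed.

Lemma supported_upperV g : Sp g -> supported <=%O g -> supported <=%O (invmx g).
Proof. by move=> gS; rewrite Sp_invE //; apply: supported_upper_sp_adj. Qed.

Lemma Sp_upper_diag g a : Sp g -> supported <=%O g ->
  g a a * g (rev_ord a) (rev_ord a) = 1.
Proof.
move=> /SpP e ug; have := congr1 (fun X : M => X a a) e.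
rewrite (supportedM_diag _ (@le_anti _ _)) ?mxE ?eqxx ?addbb ?mul1r 1?mulrC //.
exact: supported_upper_sp_adj.
Qed.

Lemma Sp_diagP (d : 'rV[F]_(n + n)) :
  Sp (diag_mx d) <-> forall a, d 0 a * d 0 (rev_ord a) = 1.
Proof.
split=> [dS a|dd].
  have := Sp_upper_diag a dS; rewrite !mxE !eqxx !mulr1n; apply=> b c.
  by rewrite mxE; have [->|_] := eqVneq b c; rewrite ?eqxx.
apply/SpP/matrixP => a b; rewrite mul_mx_diag !mxE (inj_eq rev_ord_inj) eq_sym.
have [->|_] := eqVneq a b; last by rewrite mulr0n mulr0 mul0r.
by rewrite addbb !mulr1n mul1r mulrC dd.
Qed.

Lemma UniP g : Uni g <-> Sp g /\ unisupported <=%O g.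
Proof.
split=> [[gS dg /= ug]|[gS [ug dg]]]; split=> //; first split=> //.
  by apply/supportedP => a b; rewrite leEord -ltnNge; apply: ug.
by move=> a b; rewrite ltnNge; apply: contraNeq => /ug.
Qed.

Lemma TorP g : Tor g <-> Sp g /\ supported eq_op g.
Proof.
split=> [[t t0 ->]|[gS /supported_eq_diag_mx eg]].
  split; last exact: supported_diag_mx.
  apply/Sp_diagP => a.
  wlog [i ->] : a / exists i, a = lshift n i.
    move=> W; case: (split_ordP a) => i ->; first by apply: W; exists i.
    rewrite mulrC -[X in _ * _ 0 X]rev_ordK; apply: W; exists (rev_ord i).
    by apply: val_inj => /=; have := ltn_ord i; lia.
  have -> : rev_ord (lshift n i) = rshift n (rev_ord i).
    by apply: val_inj => /=; have := ltn_ord i; lia.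
  by rewrite row_mxEl row_mxEr mxE rev_ordK mulfV.
move: {eg}(\row_a g a a) eg gS => d -> gS.
have dd := (Sp_diagP d).1 gS.
have d0 a : d 0 a != 0.
  by apply/eqP => e; have /eqP := dd a; rewrite e mul0r eq_sym oner_eq0.
exists (\row_i d 0 (lshift n i)) => [i|]; first by rewrite mxE.
congr diag_mx; apply/rowP => a; case: (split_ordP a) => i ->.
  by rewrite row_mxEl mxE.
rewrite row_mxEr !mxE; set b := lshift n _.
have -> : rshift n i = rev_ord b by apply: val_inj => /=; have := ltn_ord i; lia.
by apply: (mulfI (d0 b)); rewrite dd mulfV.
Qed.

Lemma BorP g : Bor g <-> Sp g /\ supported <=%O g.
Proof.
split=> [[t [u [/TorP[tS dt] /UniP[uS [uu _]] ->]]]|[gS ug]].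
  split; first exact: mxgM.
  exact: supported_upperM (supported_eq_upper dt) uu.
pose d := \row_a g a a; pose t := diag_mx d.
have tS : Sp t by apply/Sp_diagP => a; rewrite !mxE Sp_upper_diag.
have dt : supported eq_op t by exact: supported_diag_mx.
have ut := supported_eq_upper dt.
exists t, (invmx t *m g); split; first by apply/TorP.
  apply/UniP; split; first by apply: mxgM => //; apply: mxgV.
  split=> [|a]; first exact: supported_upperM (supported_upperV tS ut) ug.
  rewrite (supportedM_diag _ (@le_anti _ _)) //; last exact: supported_upperV.
  by rewrite Sp_invE // !mxE addbb eqxx mul1r mulrC Sp_upper_diag.
by rewrite mulKVmx // (mxg_unit tS).
Qed.

Lemma Uni_is_mxgroup : is_mxgroup (@Uni F n).
Proof.
split=> [g /UniP[/mxg_unit] //||g h /UniP[gS gu] /UniP[hS hu]|g /UniP[gS gu]].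
- by apply/UniP; split; [apply: mxg1|apply: unisupported1; exact: lexx].
- apply/UniP; split; first exact: mxgM.
  by apply: unisupportedM gu hu; [exact: le_trans|exact: le_anti].
- apply/UniP; split; first exact: mxgV.
  split=> [|a]; first by apply: supported_upperV gu.1.
  by rewrite Sp_invE // mxE addbb mul1r gu.2.
Qed.
Canonical Uni_mxgroup := MxGroup Uni_is_mxgroup.

Lemma Bor_is_mxgroup : is_mxgroup (@Bor F n).
Proof.
split=> [g /BorP[/mxg_unit] //||g h /BorP[gS gu] /BorP[hS hu]|g /BorP[gS gu]].
- by apply/BorP; split; [apply: mxg1|apply: supported1; exact: lexx].
- by apply/BorP; split; [apply: mxgM|apply: supported_upperM].
- by apply/BorP; split; [apply: mxgV|apply: supported_upperV].
Qed.
Canonical Bor_mxgroup := MxGroup Bor_is_mxgroup.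

Lemma Tor_Sp : @Tor F n `<=` @Sp F n. Proof. by move=> g /TorP[]. Qed.
Lemma Uni_Sp : @Uni F n `<=` @Sp F n. Proof. by move=> g /UniP[]. Qed.
Lemma Bor_Sp : @Bor F n `<=` @Sp F n. Proof. by move=> g /BorP[]. Qed.

Lemma Uni_Bor : @Uni F n `<=` @Bor F n.
Proof. by move=> g /UniP[gS [gu _]]; apply/BorP. Qed.

Lemma Tor_Bor : @Tor F n `<=` @Bor F n.
Proof.
by move=> g /TorP[gS gd]; apply/BorP; split; last exact: supported_eq_upper.
Qed.

Lemma opposite_BorP g : opposite (@Bor F n) g <-> Sp g /\ supported >=%O g.
Proof.
split=> [/BorP[/Sp_tr + /supported_tr]|[gS lg]]; first by rewrite trmxK.
by apply/BorP; split; [apply: Sp_tr|apply: supported_tr lg].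
Qed.

Lemma opposite_UniP g : opposite (@Uni F n) g <-> Sp g /\ unisupported >=%O g.
Proof.
split=> [/UniP[/Sp_tr + /unisupported_tr]|[gS lg]]; first by rewrite trmxK.
by apply/UniP; split; [apply: Sp_tr|apply: unisupported_tr lg].
Qed.

Lemma Tor_is_mxgroup : is_mxgroup (@Tor F n).
Proof.
have TE : @Tor F n = (@Bor F n `&` opposite (@Bor F n)).
  apply/seteqP; split=> g.
    move=> gT; split; first exact: Tor_Bor.
    have /TorP[gS gd] := gT; apply/opposite_BorP; split=> //.
    by apply: supported_sub gd => a b /eqP ->; apply: lexx.
  move=> [/BorP[gS gu] /opposite_BorP[_ gl]]; apply/TorP.
  by split=> //; apply: supported_eqE.
by rewrite TE; apply: mxgroupP.
Qed.
Canonical Tor_mxgroup := MxGroup Tor_is_mxgroup.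

Lemma Uni_conj_Tor (t u : M) : Tor t -> Uni u -> Uni (t *m u *m invmx t).
Proof.
move=> tT uU; have tB := Tor_Bor tT; have /UniP[uS [uu du]] := uU.
have /BorP[cS cu] : Bor (t *m u *m invmx t).
  by apply: mxgM (mxgV tB); apply: mxgM tB (Uni_Bor uU).
have /BorP[tS ut] := tB.
have [utV utu] := (supported_upperV tS ut, supported_upperM ut uu).
apply/UniP; split=> //; split=> // a.
rewrite !(supportedM_diag _ (@le_anti _ _)) // du mulr1.
rewrite -(supportedM_diag _ (@le_anti _ _)) //.
by rewrite mulmxV ?(mxg_unit tS) // mxE eqxx.
Qed.

Lemma Bor_opposite_Uni_inter1 g : Bor g -> opposite (@Uni F n) g -> g = 1%:M.
Proof.
move=> /BorP[_ gu] /opposite_UniP[_ gl].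
by apply: (unisupported_inter1 (@ge_anti _ _) gl).
Qed.

Lemma Bor_opposite_Uni_inj (b b' l l' : M) : Bor b -> Bor b' ->
  opposite (@Uni F n) l -> opposite (@Uni F n) l' ->
  b *m l = b' *m l' -> l = l'.
Proof.
move=> hb hb' hl hl' e; have ul' := mxg_unit hl'.
apply: (can_inj (mulmxK (_ : invmx l' \in unitmx))); first by rewrite unitmx_inv.
rewrite mulmxV //; apply: Bor_opposite_Uni_inter1; last exact: mxgM (mxgV hl').
have -> : l *m invmx l' = invmx b *m b'.
  by rewrite -[l](mulKmx (mxg_unit hb)) e mulmxA mulmxK.
exact: mxgM (mxgV hb) hb'.
Qed.

Lemma Sp_upper_lower (u l : M) : unisupported <=%O u -> supported >=%O l ->
  Sp (u *m l) -> Uni u /\ opposite (@Bor F n) l.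
Proof.
move=> uu ll /SpP; rewrite sp_adjM => e.
set P := sp_adj u *m u; set Q := l *m sp_adj l.
have uP : unisupported <=%O P.
  apply: unisupportedM (uu); [exact: le_trans|exact: le_anti|].
  split=> [|a]; first exact: supported_upper_sp_adj uu.1.
  by rewrite mxE addbb mul1r uu.2.
have lQ : supported >=%O Q.
  by apply: supported_lowerM; last exact: supported_lower_sp_adj.
have QP : Q *m P = 1%:M.
  by apply: mulmx1C; rewrite mulmxA; apply: mulmx1C; rewrite !mulmxA in e *.
have P1 := unisupported_upper_lower1 uP lQ QP.
have Q1 : Q = 1%:M by rewrite -QP P1 mulmx1.
split; first by apply/UniP; split=> //; apply/SpP.
by apply/opposite_BorP; split=> //; apply/SpP/mulmx1C.
Qed.

Lemma Sp_one_plus_Uni_oppBor f g : subadditive f -> (forall a, 1 <= f a a) ->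
  Sp g -> one_plus f g ->
  exists u l, [/\ g = u *m l, Uni u /\ one_plus f u &
    opposite (@Bor F n) l /\ one_plus f l].
Proof.
move=> ff f1 gS /(one_plus_upper_lower ff f1)[u [l [eg [uu fu] [ll fl]]]].
rewrite eg in gS *; have [uU lB] := Sp_upper_lower uu ll gS.
by exists u, l.
Qed.

Lemma Sp_one_plus_Bor_oppUni f g : subadditive f -> (forall a, 1 <= f a a) ->
  Sp g -> one_plus f g ->
  exists (b l : M), [/\ g = b *m l, Bor b & opposite (@Uni F n) l /\ one_plus f l].
Proof.
move=> ff f1 gS fg; have fTf : subadditive (fun a b => f b a).
  by move=> a c b; rewrite addrC.
have [u [l [eg [uU fu] [lB _]]]] :=
  Sp_one_plus_Uni_oppBor fTf f1 (Sp_tr gS) (one_plus_tr fg).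
exists l^T, u^T; split=> //; first by rewrite -trmx_mul -eg trmxK.
by split; [rewrite /opposite /= trmxK|apply: one_plus_tr fu].
Qed.

Lemma one_plus_SpV f g :
  (forall a b, f (rev_ord b) (rev_ord a) = f a b) ->
  Sp g -> one_plus f g -> one_plus f (invmx g).
Proof.
move=> fr gS fg a b; rewrite Sp_invE //.
have -> : sp_adj g - 1%:M = sp_adj (g - 1%:M).
  by rewrite -[in LHS]sp_adj1; apply/matrixP => c d; rewrite !mxE mulrBr.
by rewrite mxE -fr; apply/pideal_signM/fg.
Qed.

Lemma Kgrp_is_mxgroup m : is_mxgroup (@Kgrp F n m).
Proof.
split=> [g [/mxg_unit] //||g h [gS gm] [hS hm]|g [gS gm]].
- by split; [apply: mxg1|apply: one_plus1].
- by split; [apply: mxgM|apply: one_plusM gm hm => a c b; lia].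
- by split; [apply: mxgV|apply: one_plus_SpV].
Qed.
Canonical Kgrp_mxgroup m := MxGroup (Kgrp_is_mxgroup m).

End SymplecticGroup.

Section SignedPermutations.
Variables (R : comUnitRingType) (N : nat).
Local Notation M := 'M[R]_N.
Implicit Types (e : 'I_N -> bool) (s t : {perm 'I_N}) (x y A : M).

Definition sperm_mx e s : M := \matrix_(a, b) ((-1) ^+ e a *+ (b == s a)).

Lemma mul_sperm_mx e s A a b : (sperm_mx e s *m A) a b = (-1) ^+ e a * A (s a) b.
Proof.
rewrite mxE (bigD1 (s a)) //= mxE eqxx mulr1n big1 ?addr0 // => c ca.
by rewrite mxE (negPf ca) mul0r.
Qed.

Lemma mul_tr_sperm_mx e s A a b :
  (A *m (sperm_mx e s)^T) a b = (-1) ^+ e b * A a (s b).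
Proof.
by rewrite -[A *m _]trmxK trmx_mul trmxK mxE mul_sperm_mx mxE.
Qed.

Lemma sperm_mxM e d s t : sperm_mx e s *m sperm_mx d t =
  sperm_mx (fun a => e a (+) d (s a)) (s * t).
Proof.
by apply/matrixP => a b; rewrite mul_sperm_mx !mxE permM mulrnAr -signr_addb.
Qed.

Lemma sperm_mx_trK e s : sperm_mx e s *m (sperm_mx e s)^T = 1%:M.
Proof.
apply/matrixP => a b; rewrite mul_sperm_mx !mxE (inj_eq perm_inj).
by have [->|_] := eqVneq a b; rewrite ?mulr0 // mulr1n -signr_addb addbb.
Qed.

Lemma sperm_mx_unit e s : sperm_mx e s \in unitmx.
Proof. by have [] := mulmx1_unit (sperm_mx_trK e s). Qed.

Lemma sperm_mxV e s : invmx (sperm_mx e s) = (sperm_mx e s)^T.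
Proof. by rewrite -[LHS]mulmx1 -(sperm_mx_trK e s) mulKmx // sperm_mx_unit. Qed.

Lemma sperm_mx_conjE e s A a b :
  (sperm_mx e s *m A *m invmx (sperm_mx e s)) a b =
  (-1) ^+ (e a (+) e b) * A (s a) (s b).
Proof.
by rewrite sperm_mxV mul_tr_sperm_mx mul_sperm_mx signr_addb mulrA [X in X * _]mulrC.
Qed.

Definition signed_perm s x := exists e, x = sperm_mx e s.

Lemma signed_perm1 : signed_perm 1 1%:M.
Proof.
exists (fun=> false); apply/matrixP => a b.
by rewrite !mxE perm1 eq_sym.
Qed.

Lemma signed_permM s t x y :
  signed_perm s x -> signed_perm t y -> signed_perm (s * t) (x *m y).
Proof. by move=> [e ->] [d ->]; rewrite sperm_mxM; eexists. Qed.

Lemma signed_permV s x : signed_perm s x -> signed_perm s^-1 (invmx x).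
Proof.
move=> [e ->]; exists (fun a => e (s^-1%g a)); rewrite sperm_mxV.
apply/matrixP => a b; rewrite !mxE -(inj_eq (@perm_inj _ s^-1%g)) permK eq_sym.
by have [->|] := eqVneq b (s^-1%g a).
Qed.

Lemma signed_perm_unit s x : signed_perm s x -> x \in unitmx.
Proof. by move=> [e ->]; apply: sperm_mx_unit. Qed.

Lemma supported_conj s x (r : rel 'I_N) A : signed_perm s x ->
  supported r A -> supported (fun a b => r (s a) (s b)) (x *m A *m invmx x).
Proof.
move=> [e ->] rA a b; rewrite sperm_mx_conjE => nz; apply: rA.
by apply: contraNneq nz => ->; rewrite mulr0.
Qed.

Lemma unisupported_conj s x (r : rel 'I_N) A : signed_perm s x ->
  unisupported r A -> unisupported (fun a b => r (s a) (s b)) (x *m A *m invmx x).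
Proof.
move=> sx [rA dA]; split=> [|a]; first exact: supported_conj.
by case: sx => e ->; rewrite sperm_mx_conjE addbb dA mulr1.
Qed.

End SignedPermutations.

Arguments sperm_mx {R N} e s.

Section LatticeConjugation.
Variables (F : padicFieldType) (N : nat).
Implicit Types (f : 'I_N -> 'I_N -> int) (x A : 'M[F]_N).

Lemma lattice_conj s x f A : signed_perm s x ->
  lattice f A -> lattice (fun a b => f (s a) (s b)) (x *m A *m invmx x).
Proof.
by move=> [e ->] fA a b; rewrite sperm_mx_conjE; apply/pideal_signM/fA.
Qed.

Lemma conj_sub1 x A : x \in unitmx ->
  x *m A *m invmx x - 1%:M = x *m (A - 1%:M) *m invmx x.
Proof. by move=> ux; rewrite mulmxBr mulmx1 mulmxBl mulmxV. Qed.

Lemma one_plus_conj s x f A : signed_perm s x ->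
  one_plus f A -> one_plus (fun a b => f (s a) (s b)) (x *m A *m invmx x).
Proof.
move=> sx; have ux := signed_perm_unit sx.
by rewrite /one_plus /= conj_sub1 //; apply: lattice_conj.
Qed.

End LatticeConjugation.

Section SimpleReflections.
Variables (F : padicFieldType) (n : nat).
Local Notation M := 'M[F]_(n + n).
Local Notation I := 'I_(n + n).
Implicit Types (a b : I) (i : 'I_n) (s t : {perm I}).

Definition rev_equivariant s := forall a, s (rev_ord a) = rev_ord (s a).

Lemma rev_equivariant1 : rev_equivariant 1.
Proof. by move=> a; rewrite !perm1. Qed.

Lemma rev_equivariantM s t :
  rev_equivariant s -> rev_equivariant t -> rev_equivariant (s * t).
Proof. by move=> hs ht a; rewrite !permM hs ht. Qed.

Lemma rev_equivariantV s : rev_equivariant s -> rev_equivariant s^-1.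
Proof. by move=> hs a; apply: (@perm_inj _ s); rewrite hs !permKV. Qed.

Lemma Sp_sperm_mx (e : I -> bool) s : rev_equivariant s ->
  (forall a, e (rev_ord a) = in_lower_half (s a) (+) in_lower_half a (+) e a) ->
  Sp (sperm_mx e s : M).
Proof.
move=> rs he; apply/SpP; rewrite -[RHS](mulmx1C (sperm_mx_trK F e s)).
congr (_ *m _); apply/matrixP => a b; rewrite !mxE rs (inj_eq rev_ord_inj).
have [->|_] := eqVneq a (s b); last by rewrite mulr0.
by rewrite !mulr1n -signr_addb he addbA addbb.
Qed.

(* The root vectors of the i-th simple root have an entry at (srow i, scol i). *)
Definition srow i : I := lshift n i.
Definition scol i : I := ordS (srow i).

Lemma scol_mod i : (i.+1 %% (n + n))%N = i.+1.
Proof. by rewrite modn_small //; have := ltn_ord i; lia. Qed.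

Lemma val_scol i : scol i = i.+1 :> nat.
Proof. exact: scol_mod. Qed.

(* Simplification unfolds [nat_of_ord (scol i)] to a remainder. *)
Definition scolE := (scol_mod, val_scol).

Lemma srow_lt_scol i : (srow i < scol i)%N. Proof. by rewrite val_scol. Qed.

Lemma srow_neq_scol i : srow i != scol i.
Proof. by rewrite -val_eqE neq_ltn srow_lt_scol. Qed.

Definition srefl_perm i : {perm I} :=
  if (i.+1 < n)%N
  then (tperm (srow i) (scol i) * tperm (rev_ord (srow i)) (rev_ord (scol i)))%g
  else tperm (srow i) (scol i).

Lemma val_srefl_perm i a : srefl_perm i a = (if (a : nat) == i then i.+1
  else if (a : nat) == i.+1 then i : nat
  else if (a : nat) == (n + n - i.+1)%N then (n + n - i.+2)%N
  else if (a : nat) == (n + n - i.+2)%N then (n + n - i.+1)%N else a) :> nat.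
Proof.
have val_tperm (p q z : I) : tperm p q z = (if (z : nat) == p then q
    else if (z : nat) == q then p else z) :> nat.
  by rewrite !val_eqE; case: tpermP => [->|->|/eqP/negPf-> /eqP/negPf->];
    rewrite ?eqxx //; case: eqP => // ->.
rewrite /srefl_perm; have ltni := ltn_ord i; have lta := ltn_ord a.
have := val_tperm (srow i) (scol i) a; rewrite /= !scolE => vc.
case: ltnP => hi; last by rewrite vc; do 4?[case: eqP => ?]; rewrite /= ?scolE; lia.
rewrite permM [LHS]val_tperm; move: (tperm _ _ a) vc => c; rewrite /= !scolE.
by do 8?[case: eqP => ?]; rewrite /= ?scolE; lia.
Qed.

Lemma srefl_permK i : involutive (srefl_perm i).
Proof.
move=> a; apply: val_inj; rewrite /= [LHS]val_srefl_perm.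
have := val_srefl_perm i a; move: (srefl_perm i a) => b.
have := ltn_ord i; have := ltn_ord a.
by do 8?[case: eqP => ?]; lia.
Qed.

Lemma srefl_permV i : (srefl_perm i)^-1%g = srefl_perm i.
Proof.
apply/permP => a; apply: (@perm_inj _ (srefl_perm i)).
by rewrite permKV srefl_permK.
Qed.

Lemma srefl_perm_rev i : rev_equivariant (srefl_perm i).
Proof.
move=> a; apply: val_inj; rewrite /= !val_srefl_perm /=.
have := ltn_ord i; have := ltn_ord a.
by do 8?[case: eqP => ?]; lia.
Qed.

Lemma srefl_perm_srow i : srefl_perm i (srow i) = scol i.
Proof. by apply: val_inj; rewrite /= val_srefl_perm /= scolE eqxx. Qed.

Lemma srefl_perm_scol i : srefl_perm i (scol i) = srow i.
Proof. by rewrite -srefl_perm_srow srefl_permK. Qed.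

Lemma srefl_perm_inversion i a b :
  (a < b)%N -> (srefl_perm i b < srefl_perm i a)%N ->
  (a = srow i /\ b = scol i) \/ (a = rev_ord (scol i) /\ b = rev_ord (srow i)).
Proof.
rewrite !val_srefl_perm => ab h.
suff : ((a : nat) = i /\ (b : nat) = i.+1) \/
       ((a : nat) = (n + n - i.+2)%N /\ (b : nat) = (n + n - i.+1)%N).
  by case=> -[ea eb]; [left|right]; split; apply: val_inj => /=; rewrite ?scolE.
move: h; have := ltn_ord i; have := ltn_ord a; have := ltn_ord b.
by do 8?[case: eqP => ?]; lia.
Qed.

Definition srefl_sign i a := (n <= i.+1)%N && (a == scol i).

Lemma simple_reflE i : simple_refl F i = sperm_mx (srefl_sign i) (srefl_perm i).
Proof.
apply/matrixP => a b.
rewrite /simple_refl /srefl_perm /srefl_sign ltnNge -/(srow i) -/(scol i).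
case: leqP => hi; last by rewrite /= -perm_mxM !mxE eq_sym.
rewrite !mxE /=; have pq := srow_neq_scol i; case: tpermP => [->|->|/eqP ap /eqP aq].
- by rewrite (negPf pq) !eqxx andbF /=; case: eqP.
- by rewrite !eqxx andbF /= eq_sym (negPf pq) /=; case: eqP.
- by rewrite (negPf ap) (negPf aq) /= !andbT eq_sym.
Qed.

Lemma signed_perm_simple_refl i : signed_perm (srefl_perm i) (simple_refl F i).
Proof. by rewrite simple_reflE; eexists. Qed.

Lemma Sp_simple_refl i : Sp (simple_refl F i).
Proof.
rewrite simple_reflE; apply: Sp_sperm_mx (@srefl_perm_rev i) _ => a.
rewrite /srefl_sign /in_lower_half -!val_eqE val_srefl_perm /= !scolE.
have := ltn_ord i; have := ltn_ord a => ha hi.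
by do 8?[case: eqP => ?]; lia.
Qed.

End SimpleReflections.

Section WeylWords.
Variables (F : padicFieldType) (n : nat).
Local Notation M := 'M[F]_(n + n).
Local Notation I := 'I_(n + n).
Implicit Types (x y t : M) (a b : I) (i j : 'I_n) (s r : seq 'I_n).

Lemma word_mx_cons i s : word_mx F (i :: s) = simple_refl F i *m word_mx F s.
Proof. exact: big_cons. Qed.

Lemma word_mx_rcons s i : word_mx F (rcons s i) = word_mx F s *m simple_refl F i.
Proof.
elim: s => [|j s IH]; first by rewrite /word_mx big_cons !big_nil mulmx1 mul1mx.
by rewrite rcons_cons !word_mx_cons IH mulmxA.
Qed.

Definition word_perm s : {perm I} := (\prod_(i <- s) srefl_perm i)%g.

Lemma word_perm_cons i s : word_perm (i :: s) = (srefl_perm i * word_perm s)%g.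
Proof. exact: big_cons. Qed.

Lemma word_perm_cat s r : word_perm (s ++ r) = (word_perm s * word_perm r)%g.
Proof. exact: big_cat. Qed.

Lemma word_perm_rcons s i : word_perm (rcons s i) = (word_perm s * srefl_perm i)%g.
Proof. by rewrite -cats1 word_perm_cat [X in (_ * X)%g]big_seq1. Qed.

Lemma word_perm_rev s : rev_equivariant (word_perm s).
Proof.
rewrite /word_perm; elim/big_ind: _ => [||i _]; first exact: rev_equivariant1.
  exact: rev_equivariantM.
exact: srefl_perm_rev.
Qed.

Lemma signed_perm_word_mx s : signed_perm (word_perm s) (word_mx F s).
Proof.
rewrite /word_perm /word_mx; elim/big_ind2: _ => [||i _]; first exact: signed_perm1.
  by move=> x p y q; apply: signed_permM.
exact: signed_perm_simple_refl.
Qed.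

Lemma Sp_word_mx s : Sp (word_mx F s).
Proof.
rewrite /word_mx; elim/big_ind: _ => [||i _]; first exact: mxg1.
  by move=> x y; apply: mxgM.
exact: Sp_simple_refl.
Qed.

Lemma word_mx_unit s : word_mx F s \in unitmx.
Proof. exact: mxg_unit (Sp_word_mx s). Qed.

Lemma Tor_conj (p : {perm I}) x t :
  signed_perm p x -> Sp x -> Tor t -> Tor (x *m t *m invmx x).
Proof.
move=> px xS /TorP[tS dt]; apply/TorP; split.
  by apply: mxgM (mxgV xS); apply: mxgM.
by move=> a b /(supported_conj px dt); rewrite (inj_eq perm_inj).
Qed.

Lemma Tor_conj_word_mx s t : Tor t -> Tor (word_mx F s *m t *m invmx (word_mx F s)).
Proof. exact: Tor_conj (signed_perm_word_mx s) (Sp_word_mx s). Qed.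

Lemma Tor_conjV_word_mx s t : Tor t -> Tor (invmx (word_mx F s) *m t *m word_mx F s).
Proof.
rewrite -{2}[word_mx F s]invmxK.
exact: Tor_conj (signed_permV (signed_perm_word_mx s)) (mxgV (Sp_word_mx s)).
Qed.

Lemma weyl_weyl_word s : weyl (@weyl_word F n s).
Proof.
exists (word_mx F s) => //; split=> [|t]; first exact: Sp_word_mx.
split=> [|/(Tor_conjV_word_mx s)]; first exact: Tor_conj_word_mx.
by rewrite mxconjK // word_mx_unit.
Qed.

Lemma word_mx_in_weyl_word s : @weyl_word F n s (word_mx F s).
Proof. by exists 1%:M; [apply: mxg1|rewrite mulmx1]. Qed.

Lemma signed_perm_quotient_Tor (p : {perm I}) x y :
  signed_perm p x -> signed_perm p y -> Sp x -> Sp y -> Tor (invmx x *m y).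
Proof.
move=> px py xS yS; apply/TorP; split; first exact: mxgM (mxgV xS) yS.
have [e ->] := signed_permM (signed_permV px) py => a b.
by rewrite mxE mulVg perm1 eq_sym; have [//|_] := eqVneq a b; rewrite eqxx.
Qed.

Lemma eq_weyl_word s r : word_perm s = word_perm r -> @weyl_word F n s = weyl_word r.
Proof.
suff sub s' r' : word_perm s' = word_perm r' -> @weyl_word F n s' `<=` weyl_word r'.
  by move=> e; apply/seteqP; split; apply: sub.
move=> e _ [t tT <-]; exists (invmx (word_mx F r') *m word_mx F s' *m t).
  apply: mxgM tT; apply: signed_perm_quotient_Tor (Sp_word_mx _) (Sp_word_mx _).
    exact: signed_perm_word_mx.
  by rewrite -e; apply: signed_perm_word_mx.
by rewrite !mulmxA mulmxV ?mul1mx // word_mx_unit.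
Qed.

Lemma srefl_permE i a : srefl_perm i a =
  if a == srow i then scol i else if a == scol i then srow i
  else if a == rev_ord (srow i) then rev_ord (scol i)
  else if a == rev_ord (scol i) then rev_ord (srow i) else a.
Proof.
apply: val_inj; rewrite /= val_srefl_perm -!val_eqE /= !scolE.
by do 4?[case: ifP => _] => //=; rewrite ?scolE.
Qed.

Lemma srefl_perm_conj (p : {perm I}) i j : rev_equivariant p ->
  (p (srow i) = srow j /\ p (scol i) = scol j) \/
  (p (srow i) = rev_ord (scol j) /\ p (scol i) = rev_ord (srow j)) ->
  (srefl_perm i * p = p * srefl_perm j)%g.
Proof.
move=> rp pE; apply/permP => a; rewrite !permM !srefl_permE !(fun_if p).
have eqp b : (a == b) = (p a == p b) by rewrite (inj_eq perm_inj).
rewrite !eqp !rp; case: pE => -[-> ->] //; rewrite !rev_ordK; move: (p a) => b.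
apply: val_inj; rewrite !(fun_if val) -!val_eqE /= !scolE.
by have := ltn_ord j; have := ltn_ord b; do 8?[case: eqP => ?]; rewrite ?scolE; lia.
Qed.

Lemma word_perm_exchange i s : (word_perm s (scol i) < word_perm s (srow i))%N ->
  exists2 s', subseq s' s /\ (size s' < size s)%N & word_perm (i :: s) = word_perm s'.
Proof.
elim/last_ind: s => [|s j IH].
  by rewrite /word_perm big_nil !perm1; have := srow_lt_scol i; lia.
have [/IH[s' [ss' lt] e] _|le] := ltnP (word_perm s (scol i)) (word_perm s (srow i)).
  exists (rcons s' j); first by rewrite !size_rcons -!cats1 cat_subseq.
  by rewrite -rcons_cons !word_perm_rcons e.
rewrite word_perm_rcons !permM => lt'; exists s.
  by rewrite subseq_rcons size_rcons.
have lt : (word_perm s (srow i) < word_perm s (scol i))%N.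
  by rewrite ltn_neqAle le andbT val_eqE (inj_eq perm_inj) srow_neq_scol.
have /(srefl_perm_conj (word_perm_rev s)) e := srefl_perm_inversion lt lt'.
rewrite word_perm_cons word_perm_rcons mulgA e -mulgA -{1}[srefl_perm j]srefl_permV.
by rewrite mulVg mulg1.
Qed.

(* Prefixing the letters of s to p one after another, starting from the last
   one, creates a new inversion at every step. *)
Fixpoint ascending (p : {perm I}) s : bool :=
  if s is i :: s' then
    ((word_perm s' * p)%g (srow i) < (word_perm s' * p)%g (scol i))%N && ascending p s'
  else true.

Lemma ascending_rcons (p : {perm I}) s i : ascending p (rcons s i) =
  (p (srow i) < p (scol i))%N && ascending (srefl_perm i * p)%g s.
Proof.
elim: s => [|j s IH] /=; first by rewrite /word_perm big_nil mul1g.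
by rewrite IH word_perm_rcons -mulgA andbCA.
Qed.

Lemma not_ascending_shorten s : ~~ ascending 1 s ->
  exists2 s', subseq s' s /\ (size s' < size s)%N & word_perm s' = word_perm s.
Proof.
elim: s => //= i s IH; rewrite mulg1 negb_and -leqNgt => /orP[le|/IH[s' [ss' lt] e]].
  have [|s' [ss' lt] e] := @word_perm_exchange i s.
    by rewrite ltn_neqAle le val_eqE (inj_eq perm_inj) eq_sym srow_neq_scol.
  by exists s' => //; split; [apply: subseq_trans (subseq_cons _ _)|apply: ltnW].
exists (i :: s'); last by rewrite !word_perm_cons e.
by rewrite /= eqxx.
Qed.

Lemma weyl_length_spec s : exists s0, reduced_word (@weyl_word F n s) s0 /\
  forall r, @weyl_word F n r = weyl_word s ->
    (weyl_length (@weyl_word F n s) <= size r)%N.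
Proof.
set w := weyl_word s; pose Q k := `[< exists2 r, size r = k & @weyl_word F n r = w >].
have exQ : exists k, Q k by exists (size s); apply/asboolP; exists s.
case: (ex_minnP exQ) => k /asboolP[r0 sz0 e0] kmin.
have : [set k | (exists2 r, size r = k & @weyl_word F n r = w) /\
    forall r, @weyl_word F n r = w -> (k <= size r)%N] k.
  by split=> [|r e]; [exists r0|apply: kmin; apply/asboolP; exists r].
by move=> /(xgetI 0%N) /= [[s0 sz es0] min]; exists s0.
Qed.

Lemma weyl_length_le s : (weyl_length (@weyl_word F n s) <= size s)%N.
Proof. by have [_ [_]] := weyl_length_spec s; apply. Qed.

Lemma reduced_word_exists s : exists s0, reduced_word (@weyl_word F n s) s0.
Proof. by have [s0 [? _]] := weyl_length_spec s; exists s0. Qed.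

Lemma reduced_word_ascending s : reduced_word (@weyl_word F n s) s -> ascending 1 s.
Proof.
move=> [_ red]; apply: contraT => /not_ascending_shorten[s' [_ lt] /eq_weyl_word e].
by have := weyl_length_le s'; rewrite e -red leqNgt lt.
Qed.

End WeylWords.

Section RootElements.
Variables (F : padicFieldType) (n : nat).
Local Notation M := 'M[F]_(n + n).
Local Notation I := 'I_(n + n).
Implicit Types (A x : M) (a b c p q : I) (s : {perm I}) (r : F).

Definition root_vec p q r : M := \matrix_(a, b)
  (if (a == p) && (b == q) then r
   else if (a == rev_ord q) && (b == rev_ord p)
   then (-1) ^+ (in_lower_half p (+) in_lower_half (rev_ord q)) * r
   else 0).

Definition root_elt p q r : M := 1%:M + root_vec p q r.

Definition root_support p q a b :=
  (a == p) && (b == q) || (a == rev_ord q) && (b == rev_ord p).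

Lemma supported_root_vec p q r : supported (root_support p q) (root_vec p q r).
Proof.
move=> a b; rewrite mxE /root_support; case: ifP => //= _.
by case: ifP => // _; rewrite eqxx.
Qed.

Lemma root_support_neq p q a b : p != q -> root_support p q a b -> a != b.
Proof.
move=> pq /orP[]/andP[/eqP-> /eqP->] //.
by rewrite (inj_eq rev_ord_inj) eq_sym.
Qed.

Lemma root_vecM p q r r' : p != q -> root_vec p q r *m root_vec p q r' = 0.
Proof.
move=> pq; apply/matrixP => a b; rewrite mxE [RHS]mxE big1 // => c _.
apply/eqP; rewrite mulf_eq0 -implyNb; apply/implyP => /supported_root_vec h1.
apply: contraT => /supported_root_vec; move: h1; rewrite /root_support.
move=> /orP[]/andP[_ /eqP->] /orP[]/andP[+ _].
- by rewrite eq_sym (negPf pq).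
- by rewrite eq_sym rev_ord_neq.
- by rewrite rev_ord_neq.
- by rewrite (inj_eq rev_ord_inj) (negPf pq).
Qed.

Lemma sp_adj_root_vec p q r : sp_adj (root_vec p q r) = - root_vec p q r.
Proof.
apply/matrixP => a b; rewrite !mxE !eq_rev_ord !rev_ordK ![(b == _) && _]andbC.
rewrite in_lower_half_rev addbN signrN mulNr.
have [/andP[/eqP-> /eqP->]|_] := boolP ((a == p) && (b == q)).
  case: ifP => [/andP[/eqP pq _]|_]; last by rewrite mulrN signrMK.
  by rewrite pq in_lower_half_rev addNb addbb expr1 mulN1r.
case: ifP => [/andP[/eqP-> /eqP->]|_]; last by rewrite mulr0 oppr0.
by rewrite !in_lower_half_rev addNb addbN negbK opprK addbC.
Qed.

Lemma root_eltM p q r r' : p != q ->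
  root_elt p q r *m root_elt p q r' = root_elt p q (r + r').
Proof.
move=> pq; rewrite /root_elt mulmxDl mul1mx mulmxDr mulmx1 root_vecM // addr0.
rewrite -addrA; congr (_ + _); apply/matrixP => a b; rewrite !mxE.
by case: ifP => _; [rewrite addrC|case: ifP => _; ring].
Qed.

Lemma root_elt0 p q : root_elt p q 0 = 1%:M.
Proof.
rewrite /root_elt [root_vec _ _ _](_ : _ = 0) ?addr0 //; apply/matrixP => a b.
by rewrite !mxE mulr0 !if_same.
Qed.

Lemma Sp_1D_sp_adjN A : sp_adj A = - A -> A *m A = 0 -> Sp (1%:M + A).
Proof.
move=> eA AA; apply/SpP; rewrite sp_adjD sp_adj1 eA.
by rewrite mulmxDr mulmx1 mulmxBl mul1mx AA subr0 subrK.
Qed.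

Lemma Sp_root_elt p q r : p != q -> Sp (root_elt p q r).
Proof. by move=> pq; apply: Sp_1D_sp_adjN; [apply: sp_adj_root_vec|apply: root_vecM]. Qed.

Lemma root_elt_unit p q r : p != q -> root_elt p q r \in unitmx.
Proof. by move=> pq; apply: mxg_unit (Sp_root_elt r pq). Qed.

Lemma unisupported_1D (e : rel I) A :
  supported e A -> (forall a b, e a b -> a != b) ->
  unisupported (fun a b => (a == b) || e a b) (1%:M + A).
Proof.
move=> /supportedP sA ne; split=> [|a].
  apply/supportedP => a b; rewrite negb_or => /andP[/negPf ab nab].
  by rewrite !mxE ab sA // addr0.
by rewrite !mxE eqxx sA ?addr0 //; apply/negP => /ne; rewrite eqxx.
Qed.

Lemma unisupported_root_elt p q r : p != q ->
  unisupported (fun a b => (a == b) || root_support p q a b) (root_elt p q r).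
Proof.
move=> pq; apply: unisupported_1D (@supported_root_vec p q r) _ => a b.
exact: root_support_neq.
Qed.

Lemma Uni_conj_root_elt s x p q r : signed_perm s x -> Sp x -> rev_equivariant s ->
  ((s^-1)%g p < (s^-1)%g q)%N -> Uni (x *m root_elt p q r *m invmx x).
Proof.
move=> sx xS rs lt; have pq : p != q by apply: contraTneq lt => ->; rewrite ltnn.
apply/UniP; split.
  by apply: mxgM (mxgV xS); apply: mxgM xS _; apply: Sp_root_elt.
have [sE dE] := unisupported_conj sx (unisupported_root_elt r pq).
split=> //; apply: supported_sub sE => a b; rewrite (inj_eq perm_inj).
rewrite -[a](permK s) -[b](permK s) !permKV => /orP[/eqP->|]; first exact: lexx.
move=> /orP[]/andP[/eqP-> /eqP->]; first by rewrite leEord /= ltnW.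
rewrite !(rev_equivariantV rs) leEord /=.
by have := ltn_ord ((s^-1)%g q); lia.
Qed.

Lemma Uni_root_elt p q r : (p < q)%N -> Uni (root_elt p q r).
Proof.
move=> pq; have := @Uni_conj_root_elt 1 1%:M p q r.
rewrite invg1 !perm1 mul1mx invmx1 mulmx1; apply=> //.
- exact: signed_perm1.
- exact: mxg1.
- exact: rev_equivariant1.
Qed.

Lemma root_elt_mul_row p q r A b : p != q ->
  (root_elt p q r *m A) p b = A p b + r * A q b.
Proof.
move=> pq; rewrite mulmxDl mul1mx !mxE; congr (_ + _).
rewrite (bigD1 q) //= !mxE !eqxx big1 ?addr0 // => c cq.
rewrite mxE (negPf cq) andbF; case: ifP => [/andP[/eqP e /eqP ec]|_].
  by move: cq; rewrite ec e rev_ordK eqxx.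
by rewrite mul0r.
Qed.

Lemma root_elt_entry p q r : p != q -> root_elt p q r p q = r.
Proof.
move=> pq; rewrite -[root_elt _ _ _]mulmx1 root_elt_mul_row // !mxE eqxx.
by rewrite (negPf pq) add0r mulr1.
Qed.

End RootElements.

Section SimpleRoots.
Variables (F : padicFieldType) (n : nat).
Local Notation M := 'M[F]_(n + n).
Local Notation I := 'I_(n + n).
Implicit Types (u v x g : M) (a b c p q : I) (i : 'I_n) (r : F).

Lemma Uni_mul_adjacent u v p q : q = p.+1 :> nat -> Uni u -> Uni v ->
  (u *m v) p q = u p q + v p q.
Proof.
move=> qp /UniP[_ [/supportedP uu du]] /UniP[_ [/supportedP uv dv]].
have pq : q != p by rewrite -val_eqE /=; lia.
rewrite mxE (bigD1 p) //= (bigD1 q) //= big1 => [|c /andP[cp cq]].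
  by rewrite du dv mul1r mulr1 addr0 addrC.
have [lt|le] := ltnP c p; first by rewrite uu ?mul0r // leEord -ltnNge.
rewrite uv ?mulr0 // leEord; move: cp cq; rewrite -!val_eqE /=; lia.
Qed.

Lemma Uni_inv_adjacent u p q : q = p.+1 :> nat -> Uni u -> invmx u p q = - u p q.
Proof.
move=> qp hu; apply/eqP; rewrite -addr_eq0 -Uni_mul_adjacent //; last exact: mxgV.
have /negPf pq : p != q by rewrite -val_eqE /=; lia.
by rewrite mulVmx ?(mxg_unit hu) // mxE pq.
Qed.

Lemma Uni_rev_adjacent u p q : q = p.+1 :> nat -> Uni u -> u p q = 0 ->
  u (rev_ord q) (rev_ord p) = 0.
Proof.
move=> qp hu e; have := Uni_inv_adjacent qp hu.
rewrite e oppr0 (Sp_invE (Uni_Sp hu)) mxE => /eqP.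
by rewrite mulf_eq0 signr_eq0 => /eqP.
Qed.

Lemma Uni_split_simple_r u i : Uni u -> exists u1,
  [/\ Uni u1, u1 (srow i) (scol i) = 0 &
    u = u1 *m root_elt (srow i) (scol i) (u (srow i) (scol i))].
Proof.
move=> hu; set r := u _ _; have pq := srow_neq_scol i.
have hx := Uni_root_elt (- r) (srow_lt_scol i).
exists (u *m root_elt (srow i) (scol i) (- r)); split.
- exact: mxgM.
- by rewrite Uni_mul_adjacent ?val_scol // root_elt_entry // subrr.
- by rewrite -mulmxA root_eltM // addNr root_elt0 mulmx1.
Qed.

Lemma Uni_split_simple_l u i : Uni u -> exists r u1,
  [/\ Uni u1, u1 (srow i) (scol i) = 0 & u = root_elt (srow i) (scol i) r *m u1].
Proof.
move=> hu; have pq := srow_neq_scol i.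
have [u1 [hu1 e0]] := Uni_split_simple_r i (mxgV hu); set r := invmx u _ _ => e.
exists (- r), (invmx u1); split; first exact: mxgV.
  by rewrite Uni_inv_adjacent ?val_scol // e0 oppr0.
apply: (can_inj (mulKmx (_ : invmx u \in unitmx))).
  by rewrite unitmx_inv (mxg_unit hu).
rewrite mulVmx ?(mxg_unit hu) // e mulmxA -[u1 *m _ *m _]mulmxA root_eltM //.
by rewrite subrr root_elt0 mulmx1 mulmxV // (mxg_unit hu1).
Qed.

Lemma Uni_conj_simple u x i : signed_perm (srefl_perm i) x -> Sp x -> Uni u ->
  u (srow i) (scol i) = 0 -> Uni (x *m u *m invmx x).
Proof.
move=> sx xS hu u0; have /UniP[uS [uu du]] := hu.
have u0' := @Uni_rev_adjacent u (srow i) _ (val_scol i) hu u0.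
pose e a b := (a <= b)%O && ~~ root_support (srow i) (scol i) a b.
have ue : unisupported e u.
  split=> // a b nz; rewrite /e uu //=; apply: contra nz.
  by move=> /orP[]/andP[/eqP-> /eqP->]; rewrite ?u0 ?u0'.
have [sE dE] := unisupported_conj sx ue.
apply/UniP; split; first by apply: mxgM (mxgV xS); apply: mxgM.
split=> //; apply: supported_sub sE => a b /andP[]; rewrite !leEord => le.
apply: contraR; rewrite -ltnNge => ba.
have lt : (srefl_perm i a < srefl_perm i b)%N.
  rewrite ltn_neqAle le andbT val_eqE (inj_eq perm_inj).
  by apply: contraTneq ba => ->; rewrite ltnn.
have := @srefl_perm_inversion n i _ _ lt; rewrite !srefl_permK => /(_ ba).
by rewrite /root_support => -[][-> ->]; rewrite !eqxx ?orbT.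
Qed.

Definition simple_levi_support i a b := (b == a) || (b == srefl_perm i a).

Lemma simple_levi_support_trans i : transitive (simple_levi_support i).
Proof.
move=> b a c /orP[]/eqP-> // /orP[]/eqP->; rewrite /simple_levi_support ?eqxx ?orbT //.
by rewrite srefl_permK eqxx.
Qed.

Lemma supported_simple_refl i :
  supported (simple_levi_support i) (simple_refl F i).
Proof.
move=> a b; rewrite simple_reflE mxE /simple_levi_support.
by case: (b == srefl_perm i a); rewrite ?orbT ?eqxx.
Qed.

Lemma supported_simple_root_elt i p q r : q = srefl_perm i p -> p != q ->
  supported (simple_levi_support i) (root_elt p q r).
Proof.
move=> qE pq; have [sE _] := unisupported_root_elt r pq.
apply: supported_sub sE => a b; rewrite /simple_levi_support eq_sym.
move=> /orP[->//|/orP[]/andP[/eqP-> /eqP->]]; rewrite qE ?eqxx ?orbT //.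
by rewrite srefl_perm_rev srefl_permK eqxx orbT.
Qed.

(* The entry of g^-1 at (scol i, srow i) is, up to sign, the other possibly
   nonzero entry of g below the diagonal. *)
Lemma Bor_simple_levi i g : Sp g -> supported (simple_levi_support i) g ->
  g (scol i) (srow i) = 0 -> Bor g.
Proof.
move=> gS sg g0; set p := srow i in g0 *; set q := scol i in g0 *.
have row_q A b : (g *m A) q b = g q q * A q b.
  rewrite mxE (bigD1 q) //= big1 ?addr0 // => c cq.
  have [->|/sg] := eqVneq (g q c) 0; first by rewrite mul0r.
  by rewrite /simple_levi_support (negPf cq) srefl_perm_scol => /eqP->; rewrite g0 mul0r.
have gK : g *m invmx g = 1%:M by rewrite mulmxV // (mxg_unit gS).
have gqq : g q q != 0.
  apply: contra_eqN (congr1 (fun X : M => X q q) gK) => /eqP e.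
  by rewrite row_q e mul0r mxE eqxx eq_sym oner_eq0.
have rev0 : g (rev_ord p) (rev_ord q) = 0.
  have := congr1 (fun X : M => X q p) gK; rewrite row_q Sp_invE // !mxE.
  rewrite eq_sym (negPf (srow_neq_scol i)) => /eqP.
  by rewrite mulf_eq0 (negPf gqq) mulf_eq0 signr_eq0 => /eqP.
apply/BorP; split=> // a b; apply: contraR; rewrite leEord -ltnNge => ba.
apply: contraT => nz; have /orP[/eqP e|/eqP e] := sg _ _ nz.
  by rewrite e ltnn in ba.
have [|[eb ea]|[eb ea]] := @srefl_perm_inversion n i b a ba.
- by rewrite -e {2}e srefl_permK.
- by rewrite eb ea g0 eqxx in nz.
- by rewrite eb ea rev0 eqxx in nz.
Qed.

Lemma simple_refl_root_elt i r : r != 0 -> exists2 b, Bor b &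
  simple_refl F i *m root_elt (srow i) (scol i) r =
  b *m root_elt (scol i) (srow i) r^-1.
Proof.
move=> r0; have pq := srow_neq_scol i.
have qp : scol i != srow i by rewrite eq_sym.
exists (simple_refl F i *m root_elt (srow i) (scol i) r *m
  root_elt (scol i) (srow i) (- r^-1)); last first.
  by rewrite -[RHS]mulmxA root_eltM // addNr root_elt0 mulmx1.
apply: (@Bor_simple_levi i).
- by apply: mxgM (Sp_root_elt _ qp); apply: mxgM (Sp_simple_refl _ _) (Sp_root_elt _ pq).
- apply: supportedM; first exact: simple_levi_support_trans.
    apply: supportedM; first exact: simple_levi_support_trans.
      exact: supported_simple_refl.
    by apply: supported_simple_root_elt; rewrite ?srefl_perm_srow.
  by apply: supported_simple_root_elt; rewrite ?srefl_perm_scol.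
- rewrite -mulmxA simple_reflE mul_sperm_mx srefl_perm_scol root_elt_mul_row //.
  rewrite root_elt_entry // (unisupported_root_elt _ qp).2 mulrN mulfV //.
  by rewrite subrr mulr0.
Qed.

Lemma root_elt_simple_refl i r : r != 0 -> exists2 b, Bor b &
  root_elt (srow i) (scol i) r *m simple_refl F i =
  root_elt (scol i) (srow i) r^-1 *m b.
Proof.
move=> r0; have pq := srow_neq_scol i; set x := simple_refl F i.
have qp : scol i != srow i by rewrite eq_sym.
have xS : Sp x := Sp_simple_refl F i; have ux := mxg_unit xS.
have xxT : Tor (x *m x).
  rewrite -{1}[x]invmxK; apply: (@signed_perm_quotient_Tor _ _ (srefl_perm i)) => //.
  - by rewrite -srefl_permV; apply/signed_permV/signed_perm_simple_refl.
  - exact: signed_perm_simple_refl.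
  - exact: mxgV.
have [|b hb e] := @simple_refl_root_elt i (- r); first by rewrite oppr_eq0.
exists (invmx b *m (x *m x)); first exact: mxgM (mxgV hb) (Tor_Bor xxT).
suff <- : root_elt (scol i) (srow i) r^-1 *m (invmx b *m x) =
    root_elt (srow i) (scol i) r.
  by rewrite !mulmxA.
apply: (can_inj (mulmxK (root_elt_unit (- r) pq))).
rewrite root_eltM // subrr root_elt0 -!mulmxA e mulKmx ?(mxg_unit hb) //.
by rewrite root_eltM // invrN subrr root_elt0.
Qed.

End SimpleRoots.

Section BruhatCells.
Variables (F : padicFieldType) (n : nat).
Local Notation M := 'M[F]_(n + n).
Implicit Types (x g b c t u : M) (i : 'I_n) (s : seq 'I_n) (r : F).

Lemma bruhat_cellM x g b c : Bor b -> Bor c ->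
  bruhat_cell x g -> bruhat_cell x (b *m g *m c).
Proof.
move=> hb hc [b1 [b2 [h1 h2 ->]]]; exists (b *m b1), (b2 *m c).
by split; [exact: mxgM|exact: mxgM|rewrite !mulmxA].
Qed.

Lemma bruhat_cell_id x : bruhat_cell x x.
Proof.
by exists 1%:M, 1%:M; split; rewrite ?mulmx1 ?mul1mx //; apply: mxg1.
Qed.

Lemma bruhat_cell_Sp s g : bruhat_cell (word_mx F s) g -> Sp g.
Proof.
move=> [b1 [b2 [/Bor_Sp h1 /Bor_Sp h2 ->]]].
by apply: mxgM h2; apply: mxgM h1 (Sp_word_mx _ _).
Qed.

Lemma weyl_word_torus s x : weyl_word s x -> exists2 t, Tor t & x = t *m word_mx F s.
Proof.
move=> [t tT <-]; exists (word_mx F s *m t *m invmx (word_mx F s)).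
  exact: Tor_conj_word_mx.
by rewrite mulmxKV // word_mx_unit.
Qed.

Lemma bruhat_cell_weyl_word s x y : weyl_word s x -> weyl_word s y ->
  bruhat_cell x `<=` bruhat_cell y.
Proof.
move=> /weyl_word_torus[t tT ->] /weyl_word_torus[t' tT' ->] _ [b [c [hb hc ->]]].
exists (b *m t *m invmx t'), c; split=> //; last first.
  by rewrite !mulmxA mulmxKV // (mxg_unit tT').
by apply: mxgM (mxgV (Tor_Bor tT')); apply: mxgM hb (Tor_Bor tT).
Qed.

Lemma bruhat_cell_normal_form s g : bruhat_cell (word_mx F s) g ->
  exists u t u', [/\ Uni u, Tor t, Uni u' & g = u *m (t *m word_mx F s *m u')].
Proof.
set x := word_mx F s => -[_ [_ [[t1 [u1 [h1 v1 ->]]] [t2 [u2 [h2 v2 ->]]] ->]]].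
exists (t1 *m u1 *m invmx t1), (t1 *m (x *m t2 *m invmx x)), u2; split=> //.
- exact: Uni_conj_Tor.
- exact: mxgM h1 (Tor_conj_word_mx _ h2).
- have ux : x \in unitmx := word_mx_unit F s.
  by rewrite !mulmxA (mulmxKV (mxg_unit h1)) (mulmxKV ux).
Qed.

Lemma bruhat_cell_root_simple s i r :
  let g := word_mx F s *m root_elt (srow i) (scol i) r *m simple_refl F i in
  bruhat_cell (word_mx F (rcons s i)) g \/ bruhat_cell (word_mx F s) g.
Proof.
move=> g; rewrite word_mx_rcons; set y := word_mx F s in g *.
have uy : y \in unitmx := word_mx_unit F s.
have yU p q z : (((word_perm s)^-1)%g p < ((word_perm s)^-1)%g q)%N ->
    Bor (y *m root_elt p q z *m invmx y).
  move=> lt; apply: Uni_Bor.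
  apply: Uni_conj_root_elt (Sp_word_mx F s) (@word_perm_rev n s) lt.
  exact: signed_perm_word_mx.
have mv h : y *m h = y *m h *m invmx y *m y by rewrite mulmxKV.
have [lt|] := ltnP ((word_perm s)^-1%g (srow i)) ((word_perm s)^-1%g (scol i)).
  left; rewrite /g (mv (root_elt _ _ _)) -mulmxA -[X in bruhat_cell _ X]mulmx1.
  exact: bruhat_cellM (yU _ _ _ lt) (mxg1 _) (bruhat_cell_id _).
rewrite leq_eqVlt val_eqE (inj_eq perm_inj) eq_sym (negPf (srow_neq_scol i)) /= => lt.
have [r0|r0] := eqVneq r 0.
  by left; rewrite /g r0 root_elt0 mulmx1; apply: bruhat_cell_id.
right; have [b hb e] := root_elt_simple_refl i r0.
rewrite /g -mulmxA e mulmxA (mv (root_elt _ _ _)).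
exact: bruhat_cellM (yU _ _ _ lt) hb (bruhat_cell_id _).
Qed.

Lemma bruhat_cell_simple_mul s i g b : bruhat_cell (word_mx F s) g -> Bor b ->
  bruhat_cell (word_mx F (rcons s i)) (g *m simple_refl F i *m b) \/
  bruhat_cell (word_mx F s) (g *m simple_refl F i *m b).
Proof.
move=> /bruhat_cell_normal_form[u [t [u' [hu ht hu' ->]]]] hb.
have [r [u1 [hu1 u10 ->]]] := Uni_split_simple_l i hu'.
set x := simple_refl F i; have xS : Sp x := Sp_simple_refl F i.
have ux := mxg_unit xS.
have hv : Uni (invmx x *m u1 *m x).
  rewrite -{2}[x]invmxK; apply: (@Uni_conj_simple _ _ _ _ i) => //.
    by rewrite -srefl_permV; apply/signed_permV/signed_perm_simple_refl.
  exact: mxgV.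
have -> : u *m (t *m word_mx F s *m (root_elt (srow i) (scol i) r *m u1)) *m x *m b =
    (u *m t) *m (word_mx F s *m root_elt (srow i) (scol i) r *m x) *m
    (invmx x *m u1 *m x *m b).
  by rewrite !mulmxA mulmxK.
have [but bvb] : Bor (u *m t) /\ Bor (invmx x *m u1 *m x *m b).
  by split; [apply: mxgM (Uni_Bor hu) (Tor_Bor ht)|apply: mxgM (Uni_Bor hv) hb].
by have [cell|cell] := bruhat_cell_root_simple s i r; [left|right]; apply: bruhat_cellM.
Qed.

Definition lower_cells s : set M :=
  [set g | exists2 s', subseq s' s /\ (size s' < size s)%N &
                       bruhat_cell (word_mx F s') g].

Lemma lower_cells_rcons s i g b : lower_cells s g -> Bor b ->
  lower_cells (rcons s i) (g *m simple_refl F i *m b).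
Proof.
move=> [s' [ss' lt] cell] hb.
have [cell'|cell'] := bruhat_cell_simple_mul i cell hb.
  by exists (rcons s' i); rewrite // !size_rcons -!cats1 cat_subseq.
exists s' => //; split; last by rewrite size_rcons ltnW.
exact: subseq_trans ss' (subseq_rcons _ _).
Qed.

End BruhatCells.

Section TiltedLattices.
Variables (F : padicFieldType) (n : nat).
Local Notation M := 'M[F]_(n + n).
Local Notation I := 'I_(n + n).
Implicit Types (A g h : M) (a b c p q : I) (theta : I -> int) (m : int) (X Y : pred I).

Definition rev_constant theta := exists k, forall a, theta a + theta (rev_ord a) = k.

Lemma rev_constant_comp theta (p : {perm I}) : rev_equivariant p ->
  rev_constant theta -> rev_constant (theta \o p).
Proof. by move=> rp [k hk]; exists k => a /=; rewrite rp. Qed.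

Definition tilt theta m a b : int := theta a - theta b + m.

(* The conjugates of x_{-alpha}(1/r), for a large r, by [one_plus (tilt theta m)]
   lie in [one_plus (root_tilt theta m X Y)], where X and Y are the rows and the
   columns of the root vector; an entry gains m for each index outside X, Y. *)
Definition root_tilt theta m X Y a b : int :=
  tilt theta (1 - m) a b + (if X a then 0 else m) + (if Y b then 0 else m).

Lemma tilt_subadditive theta m : 0 <= m -> subadditive (tilt theta m).
Proof. by move=> m0 a c b; rewrite /tilt; lia. Qed.

Lemma tilt_rev theta m a b : rev_constant theta ->
  tilt theta m (rev_ord b) (rev_ord a) = tilt theta m a b.
Proof. by move=> [k hk]; rewrite /tilt; have := hk a; have := hk b; lia. Qed.

Lemma root_tilt_subadditive theta m X Y : 0 <= m ->
  (forall a, ~~ (X a && Y a)) -> subadditive (root_tilt theta m X Y).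
Proof.
move=> m0 dXY a c b; have := dXY c; rewrite /root_tilt /tilt.
by move: (X a) (X c) (Y c) (Y b) => [] [] [] []; lia.
Qed.

Lemma root_tilt_diag theta m X Y a : 0 <= m ->
  (forall a, ~~ (X a && Y a)) -> 1 <= root_tilt theta m X Y a a.
Proof.
move=> m0 /(_ a); rewrite /root_tilt /tilt.
by move: (X a) (Y a) => [] []; lia.
Qed.

Lemma one_plus_root_tilt_conj theta m X Y g h : 0 <= m -> h \in unitmx ->
  one_plus (tilt theta m) h -> one_plus (tilt theta m) (invmx h) ->
  one_plus (root_tilt theta m X Y) g ->
  one_plus (root_tilt theta m X Y) (invmx h *m g *m h).
Proof.
move=> m0 uh fh fhV; rewrite /one_plus /=.
rewrite -{2}[h]invmxK conj_sub1 ?unitmx_inv // invmxK; set A := g - 1%:M => fA.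
have fAV : lattice (root_tilt theta m X Y) (invmx h *m A).
  rewrite -[invmx h](subrK 1%:M) mulmxDl mul1mx; apply: latticeD (fA).
  apply: latticeM fhV fA => a c b; rewrite /root_tilt /tilt.
  by move: (X a) (X c) (Y b) => [] [] []; lia.
rewrite -{2}[h](subrK 1%:M) mulmxDr mulmx1; apply: latticeD (fAV).
apply: latticeM fAV fh => a c b; rewrite /root_tilt /tilt.
by move: (X a) (Y c) (Y b) => [] [] []; lia.
Qed.

Lemma one_plus_root_elt (f : I -> I -> int) p q r :
  pideal (f p q) r -> pideal (f (rev_ord q) (rev_ord p)) r ->
  one_plus f (root_elt p q r : M).
Proof.
move=> fpq fqp a b; rewrite /root_elt addrAC subrr add0r mxE.
case: ifP => [/andP[/eqP-> /eqP->] //|_].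
by case: ifP => [/andP[/eqP-> /eqP->]|_]; [apply/pideal_signM|left].
Qed.

Lemma one_plus_tilt_root_elt theta m p q r : rev_constant theta ->
  pideal (tilt theta m p q) r -> one_plus (tilt theta m) (root_elt p q r : M).
Proof. by move=> th hr; apply: one_plus_root_elt; rewrite ?tilt_rev. Qed.

Lemma one_plus_tilt_root_eltV theta m p q r : rev_constant theta -> p != q ->
  pideal (tilt theta m p q) r -> one_plus (tilt theta m) (invmx (root_elt p q r : M)).
Proof.
move=> th pq hr; apply: one_plus_SpV; last exact: one_plus_tilt_root_elt.
  by move=> a b; apply: tilt_rev.
exact: Sp_root_elt.
Qed.

Lemma one_plus_root_tilt_root_elt theta m p q r : rev_constant theta ->
  ~ pideal (tilt theta m p q) r ->
  one_plus (root_tilt theta m (pred2 q (rev_ord p)) (pred2 p (rev_ord q)))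
    (root_elt q p r^-1 : M).
Proof.
move=> th /notin_pidealV hr.
have e : tilt theta (1 - m) q p = 1 - tilt theta m p q by rewrite /tilt; lia.
by apply: one_plus_root_elt; rewrite /root_tilt /= !eqxx ?orbT !addr0 ?tilt_rev // e.
Qed.

Lemma disjoint_root_rows_columns p q : p != q ->
  forall a, ~~ (pred2 q (rev_ord p) a && pred2 p (rev_ord q) a).
Proof.
move=> pq a; apply/negP => /andP[/orP[]/eqP-> /orP[]].
- by rewrite eq_sym (negPf pq).
- by rewrite eq_sym rev_ord_neq.
- by rewrite rev_ord_neq.
- by rewrite (inj_eq rev_ord_inj) (negPf pq).
Qed.

End TiltedLattices.

Section SplitOrDegenerate.
Variables (F : padicFieldType) (n : nat).
Local Notation M := 'M[F]_(n + n).
Local Notation I := 'I_(n + n).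
Implicit Types (g h u c x : M) (i : 'I_n) (s : seq 'I_n) (p : {perm I}).
Implicit Types (theta : I -> int) (H : set M).

(* u lies in (U cap w^-1 U w) H, where w is the Weyl element of the word s. *)
Definition splits s H u := exists u' h, [/\ u = u' *m h, Uni u',
  Uni (word_mx F s *m u' *m invmx (word_mx F s)) & H h].

Definition degenerates theta (m : int) s u :=
  exists c g (X Y : pred I), [/\ lower_cells s c, word_mx F s *m u = c *m g,
    Sp g, forall a, ~~ (X a && Y a) & one_plus (root_tilt theta m X Y) g].

Definition concordant p (a b : I) := (a <= b)%O && (p a <= p b)%O.

Definition small_concordant theta (m : int) p : set M :=
  [set h | [/\ Sp h, unisupported (concordant p) h & one_plus (tilt (theta \o p) m) h]].

Lemma concordant_trans p : transitive (concordant p).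
Proof.
move=> b a c /andP[ab pab] /andP[bc pbc].
by rewrite /concordant (le_trans ab bc) (le_trans pab pbc).
Qed.

Lemma concordant_anti p : antisymmetric (concordant p).
Proof. by move=> a b /andP[/andP[ab _] /andP[ba _]]; apply: le_anti; rewrite ab. Qed.

Lemma Uni_concordant p h : Sp h -> unisupported (concordant p) h -> Uni h.
Proof.
move=> hS [sh dh]; apply/UniP; split=> //; split=> //.
by apply: supported_sub sh => a b /andP[].
Qed.

Lemma concordant_root_elt p i (r : F) : rev_equivariant p ->
  (p (srow i) < p (scol i))%N ->
  unisupported (concordant p) (root_elt (srow i) (scol i) r).
Proof.
move=> rp lt; have [sE dE] := unisupported_root_elt r (srow_neq_scol i).
split=> //; apply: supported_sub sE => a b; rewrite /concordant.
move=> /orP[/eqP->|/orP[]/andP[/eqP-> /eqP->]]; rewrite ?lexx //.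
  by rewrite !leEord (ltnW lt) (ltnW (srow_lt_scol i)).
rewrite !rp !leEord; apply/andP.
by split; apply: leq_sub2l; apply: ltnW; rewrite ?ltnS ?srow_lt_scol.
Qed.

Lemma concordant_conj_simple p i h : rev_equivariant p ->
  (p (srow i) < p (scol i))%N ->
  unisupported (concordant (srefl_perm i * p)) h ->
  unisupported (concordant p) (invmx (simple_refl F i) *m h *m simple_refl F i).
Proof.
move=> rp lt sh; have sx := signed_permV (signed_perm_simple_refl F i).
have := unisupported_conj sx sh; rewrite invmxK srefl_permV => -[sE dE]; split=> //.
apply: supported_sub sE => a b; rewrite /concordant !permM !srefl_permK.
move=> /andP[le pab]; rewrite pab andbT leNgt; apply/negP => ba.
have ne : srefl_perm i a != srefl_perm i b.
  by rewrite (inj_eq perm_inj); apply: contraTneq ba => ->; rewrite ltxx.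
have [||[eb ea]|[eb ea]] := @srefl_perm_inversion n i b a.
- exact: ba.
- by rewrite ltn_neqAle val_eqE ne.
- by move: pab; rewrite eb ea leEord leqNgt lt.
- by move: pab; rewrite eb ea !rp leEord /=; have := ltn_ord (p (scol i)); lia.
Qed.

Lemma splits_nil H u : H 1%:M -> Uni u -> splits [::] H u.
Proof.
move=> H1 hu; exists u, 1%:M; split; rewrite ?mulmx1 //.
by rewrite /word_mx big_nil mul1mx invmx1 mulmx1.
Qed.

Section PeelLastLetter.
Variables (theta : I -> int) (m : int) (s : seq 'I_n) (i : 'I_n) (u : M).
Hypotheses (theta_rev : rev_constant theta) (m0 : 0 <= m) (hu : Uni u).
Let r := u (srow i) (scol i).
Let x := simple_refl F i.

Lemma degenerates_large_entry :
  ~ pideal (tilt theta m (srow i) (scol i)) r -> degenerates theta m (rcons s i) u.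
Proof.
move=> hr; have pq := srow_neq_scol i.
have ux : x \in unitmx := mxg_unit (Sp_simple_refl F i).
have [u1 [hu1 u10 eu]] := Uni_split_simple_r i hu.
have r0 : r != 0 by apply/eqP => e; apply: hr; rewrite e; left.
have hxu1 : Uni (x *m u1 *m invmx x).
  exact: Uni_conj_simple (signed_perm_simple_refl F i) (Sp_simple_refl F i) hu1 u10.
have [b hb eb] := simple_refl_root_elt i r0.
exists (word_mx F s *m (x *m u1 *m invmx x *m b)), (root_elt (scol i) (srow i) r^-1).
exists (pred2 (scol i) (rev_ord (srow i))), (pred2 (srow i) (rev_ord (scol i))).
split.
- exists s; first by rewrite subseq_rcons size_rcons.
  rewrite -[X in bruhat_cell _ X]mul1mx mulmxA.
  apply: bruhat_cellM (bruhat_cell_id _); first exact: mxg1.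
  exact: mxgM (Uni_Bor hxu1) hb.
- rewrite word_mx_rcons [in LHS]eu -!mulmxA -eb !mulmxA.
  by rewrite (mulmxKV ux).
- by apply: Sp_root_elt; rewrite eq_sym.
- exact: disjoint_root_rows_columns.
- exact: one_plus_root_tilt_root_elt.
Qed.

Hypothesis r_small : pideal (tilt theta m (srow i) (scol i)) r.

Lemma degenerates_rcons u1 : u = u1 *m root_elt (srow i) (scol i) r ->
  degenerates (theta \o srefl_perm i) m s (x *m u1 *m invmx x) ->
  degenerates theta m (rcons s i) u.
Proof.
move=> eu [c [g [X [Y [hc e gS dXY fg]]]]]; have pq := srow_neq_scol i.
have xS : Sp x := Sp_simple_refl F i; have ux := mxg_unit xS.
set z := root_elt (srow i) (scol i) r in eu.
have zS : Sp z := Sp_root_elt r pq; have uz := mxg_unit zS.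
exists (c *m x *m z), (invmx z *m (invmx x *m g *m x) *m z).
exists (X \o srefl_perm i), (Y \o srefl_perm i); split.
- exact: lower_cells_rcons hc (Uni_Bor (Uni_root_elt r (srow_lt_scol i))).
- have -> : c *m x *m z *m (invmx z *m (invmx x *m g *m x) *m z) = c *m g *m x *m z.
    by rewrite !mulmxA !mulmxK.
  by rewrite -e word_mx_rcons eu !mulmxA mulmxKV.
- apply: mxgM (zS); apply: mxgM (mxgV zS) _.
  by apply: mxgM (xS); apply: mxgM (mxgV xS) gS.
- by move=> a; apply: dXY.
- apply: one_plus_root_tilt_conj => //; first exact: one_plus_tilt_root_elt.
    exact: one_plus_tilt_root_eltV.
  rewrite -{2}[x]invmxK.
  have := one_plus_conj (signed_permV (signed_perm_simple_refl F i)) fg.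
  by apply: one_plus_le => a b; rewrite srefl_permV /root_tilt /tilt /= !srefl_permK.
Qed.

Lemma splits_rcons p u1 theta0 : theta = theta0 \o p -> rev_equivariant p ->
  (p (srow i) < p (scol i))%N ->
  u = u1 *m root_elt (srow i) (scol i) r -> Uni u1 ->
  splits s (small_concordant theta0 m (srefl_perm i * p)) (x *m u1 *m invmx x) ->
  splits (rcons s i) (small_concordant theta0 m p) u.
Proof.
move=> eth rp lt eu hu1 [u' [h' [e hu' hyu' [hS' sh' fh']]]].
have xS : Sp x := Sp_simple_refl F i; have ux := mxg_unit xS.
have sxV : signed_perm (srefl_perm i) (invmx x).
  by rewrite -srefl_permV; apply/signed_permV/signed_perm_simple_refl.
pose h := invmx x *m h' *m x; pose v := invmx x *m u' *m x.
have hS : Sp h by apply: mxgM (xS); apply: mxgM (mxgV xS) hS'.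
have sh : unisupported (concordant p) h := concordant_conj_simple rp lt sh'.
have fh : one_plus (tilt theta m) h.
  have := one_plus_conj sxV fh'; rewrite invmxK eth; apply: one_plus_le => a b.
  by rewrite /tilt /= !permM !srefl_permK.
have e1 : u1 = v *m h.
  by rewrite -[u1](mxconjK _ ux) e /v /h !mulmxA mulmxK.
have hU : Uni h := Uni_concordant hS sh.
exists v, (h *m root_elt (srow i) (scol i) r); split.
- by rewrite mulmxA -e1.
- by rewrite -[v](mulmxK (mxg_unit hU)) -e1; apply: mxgM hu1 (mxgV hU).
- rewrite word_mx_rcons invmxM ?word_mx_unit //.
  by rewrite /v !mulmxA !mulmxK.
split; first exact: mxgM hS (Sp_root_elt _ (srow_neq_scol i)).
- apply: unisupportedM sh _; [exact: concordant_trans|exact: concordant_anti|].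
  exact: concordant_root_elt.
- rewrite -eth; apply: one_plusM; [exact: tilt_subadditive|exact: fh|].
  exact: one_plus_tilt_root_elt.
Qed.

End PeelLastLetter.

Lemma splits_or_degenerates theta (m : int) p s u :
  rev_constant theta -> 0 <= m -> rev_equivariant p -> ascending p s -> Uni u ->
  splits s (small_concordant theta m p) u \/ degenerates (theta \o p) m s u.
Proof.
move=> th m0; elim/last_ind: s p u => [|s i IH] p u rp.
  move=> _ hu; left; apply: splits_nil => //; split; first exact: mxg1.
    by apply: unisupported1 => a; rewrite /concordant !lexx.
  exact: one_plus1.
rewrite ascending_rcons => /andP[lt asc] hu.
have thp := rev_constant_comp rp th.
have [small|] := pselect (pideal (tilt (theta \o p) m (srow i) (scol i))
  (u (srow i) (scol i))); last by right; apply: degenerates_large_entry.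
have [u1 [hu1 u10 eu]] := Uni_split_simple_r i hu.
have hxu1 := Uni_conj_simple (signed_perm_simple_refl F i) (Sp_simple_refl F i) hu1 u10.
have [|sp|dg] := IH _ _ _ asc hxu1.
- exact: rev_equivariantM (@srefl_perm_rev n i) rp.
- by left; apply: (splits_rcons thp m0 small erefl rp lt eu hu1 sp).
- right; apply: (degenerates_rcons thp m0 small eu).
  by congr degenerates: dg; apply/funext => a /=; rewrite permM.
Qed.

End SplitOrDegenerate.

Section UniformizerDiagonal.
Variables (F : padicFieldType) (N : nat) (varpi : F).
Hypothesis hvarpi : uniformizer varpi.
Implicit Types (A : 'M[F]_N) (e : 'I_N -> int).

Definition varpi_diag e : 'M[F]_N := diag_mx (\row_a varpi ^ e a).

Lemma varpi_diagE e a b : varpi_diag e a b = varpi ^ e a *+ (a == b).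
Proof. by rewrite !mxE. Qed.

Lemma varpi_diagK e : varpi_diag e *m varpi_diag (fun a => - e a) = 1%:M.
Proof.
have [v0 _] := hvarpi; apply/matrixP => a b; rewrite mul_diag_mx !mxE.
have [->|_] := eqVneq a b; last by rewrite mulr0.
by rewrite !mulr1n -expfzDr // subrr expr0z.
Qed.

Lemma varpi_diag_unit e : varpi_diag e \in unitmx.
Proof. by have [] := mulmx1_unit (varpi_diagK e). Qed.

Lemma varpi_diagV e : invmx (varpi_diag e) = varpi_diag (fun a => - e a).
Proof. by rewrite -[LHS]mulmx1 -(varpi_diagK e) mulKmx // varpi_diag_unit. Qed.

Lemma varpi_diag_conjE e A a b :
  (varpi_diag e *m A *m invmx (varpi_diag e)) a b = varpi ^ (e a - e b) * A a b.
Proof.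
have [v0 _] := hvarpi.
by rewrite varpi_diagV mul_mx_diag mxE mul_diag_mx !mxE expfzDr // mulrAC.
Qed.

Lemma lattice_conj_varpi_diag e (f f' : 'I_N -> 'I_N -> int) A :
  (forall a b, f' a b = e a - e b + f a b) -> lattice f A ->
  lattice f' (varpi_diag e *m A *m invmx (varpi_diag e)).
Proof.
move=> ff' fA a b; rewrite varpi_diag_conjE ff'.
exact: pidealM (pideal_uniformizer_expz _ hvarpi) (fA a b).
Qed.

Lemma one_plus_conj_varpi_diag e (f f' : 'I_N -> 'I_N -> int) A :
  (forall a b, f' a b = e a - e b + f a b) -> one_plus f A ->
  one_plus f' (varpi_diag e *m A *m invmx (varpi_diag e)).
Proof.
rewrite /one_plus /= conj_sub1 ?varpi_diag_unit //.
exact: lattice_conj_varpi_diag.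
Qed.

End UniformizerDiagonal.

Section HoweGroups.
Variables (F : padicFieldType) (n : nat).
Local Notation M := 'M[F]_(n + n).
Local Notation I := 'I_(n + n).
Implicit Types (g h u l : M) (a b : I) (m k C : nat).

Definition howe_weight m a : int := (2 * m * a)%N%:Z.

Definition howe_tilt m : I -> I -> int := tilt (howe_weight m) m%:Z.

(* H_m, in a form that does not mention the uniformizer. *)
Definition howe_group m : set M := @Sp F n `&` one_plus (howe_tilt m).

Lemma howe_weight_rev m : rev_constant (howe_weight m).
Proof.
exists (2 * m * (n + n).-1)%N%:Z => a; rewrite /howe_weight -PoszD -mulnDr /=.
by congr ((_ * _)%N%:Z); have := ltn_ord a; lia.
Qed.

Lemma howe_tilt_subadditive m : subadditive (howe_tilt m).
Proof. exact: tilt_subadditive. Qed.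

Lemma howe_tiltE m a b : howe_tilt m a b = (2 * (a%:Z - b%:Z) + 1) * m%:Z.
Proof. by rewrite /howe_tilt /tilt /howe_weight; lia. Qed.

Lemma howe_tilt_diag m a : (0 < m)%N -> 1 <= howe_tilt m a a.
Proof. by rewrite howe_tiltE; lia. Qed.

Lemma howe_group_is_mxgroup m : is_mxgroup (howe_group m).
Proof.
split=> [g [/mxg_unit] //||g h [gS gm] [hS hm]|g [gS gm]].
- by split; [apply: mxg1|apply: one_plus1].
- split; [exact: mxgM|exact: one_plusM (howe_tilt_subadditive m) gm hm].
- split; [exact: mxgV|apply: one_plus_SpV gS gm => a b].
  exact/tilt_rev/howe_weight_rev.
Qed.
Canonical howe_group_mxgroup m := MxGroup (howe_group_is_mxgroup m).

Lemma Kgrp_Uni_sub_howe_group C m : @Uni F n `&` Kgrp C `<=` howe_group m.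
Proof.
move=> u [/UniP[uS uu] [_ uC]]; split=> //.
apply: one_plus_unisupported uu _ uC => a b; rewrite leEord -val_eqE howe_tiltE /=.
by nia.
Qed.

Lemma howe_group_Uni_sub k m : (k <= m)%N ->
  @Uni F n `&` howe_group k `<=` @Uni F n `&` howe_group m.
Proof.
move=> km u [uU [uS uk]]; split=> //; split=> //; have [_ uu] := (UniP _).1 uU.
apply: one_plus_unisupported uu _ uk => a b.
by rewrite leEord -val_eqE !howe_tiltE /=; nia.
Qed.

Lemma opposite_Bor_howe_group_sub C k : (C <= k)%N ->
  opposite (@Bor F n) `&` howe_group k `<=` Kgrp C.
Proof.
move=> Ck l [/opposite_BorP[lS ll] [_ lk]]; split=> // a b.
have [ba|ab] := leP b a.
  apply: pideal_le (lk a b); rewrite howe_tiltE.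
  by move: ba; rewrite leEord; nia.
have l0 : l a b = 0 by apply: ((supportedP _ _).1 ll); rewrite /= -ltNge.
by left; rewrite !mxE l0 lt_eqF // subrr.
Qed.

Section Uniformizer.
Variable varpi : F.
Hypothesis hvarpi : uniformizer varpi.

Definition dmx_weight m a : int := ((2 * a + 1)%N%:Z - (2 * n)%N%:Z) * m%:Z.

Lemma dmxE m : dmx n varpi m = varpi_diag varpi (dmx_weight m).
Proof. by []. Qed.

Lemma Tor_varpi_diag (e : I -> int) : (forall a, e a + e (rev_ord a) = 0) ->
  Tor (varpi_diag varpi e).
Proof.
move=> he; apply/TorP; split; last exact: supported_diag_mx.
have [v0 _] := hvarpi.
by apply/Sp_diagP => a; rewrite !mxE -expfzDr // he expr0z.
Qed.

Lemma Tor_dmx m : Tor (dmx n varpi m).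
Proof.
apply: Tor_varpi_diag => a; rewrite -mulrDl [X in X * _](_ : _ = 0) ?mul0r //=.
by have := ltn_ord a; lia.
Qed.

Lemma HgrpE m : Hgrp varpi m = howe_group m.
Proof.
have dS := Tor_Sp (Tor_dmx m); have ud := mxg_unit dS.
have hE a b : howe_tilt m a b = dmx_weight m a - dmx_weight m b + m%:Z.
  by rewrite howe_tiltE /dmx_weight; lia.
apply/seteqP; split=> [_ [k [kS km] <-]|h [hS hm]].
  split; first by apply: mxgM (mxgV dS); apply: mxgM.
  exact: one_plus_conj_varpi_diag km.
exists (invmx (dmx n varpi m) *m h *m dmx n varpi m); last exact: mxconjVK.
split; first by apply: mxgM (dS); apply: mxgM (mxgV dS) hS.
rewrite -{2}[dmx n varpi m]invmxK dmxE varpi_diagV //.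
by apply: (one_plus_conj_varpi_diag hvarpi _ hm) => a b; rewrite hE; lia.
Qed.

Lemma psiH_psiU (R : realType) (psi : F -> R[i]) m h :
  psiH varpi psi m h = psiU psi h.
Proof.
have [v0 _] := hvarpi; rewrite /psiH /tau /psiU /superdiag mulr_sumr; congr psi.
apply: eq_bigr => i _; rewrite -/(srow i) -/(scol i).
rewrite -{2}[dmx n varpi m]invmxK dmxE varpi_diagV // varpi_diag_conjE //.
rewrite mulrA -expfzDr // [X in varpi ^ X](_ : _ = 0) ?expr0z ?mul1r //.
by rewrite /dmx_weight val_scol /=; lia.
Qed.

End Uniformizer.

End HoweGroups.

Section Topology.
Variables (F : padicFieldType).

Lemma nbhs_pideal (x : F) (k : int) : nbhs x [set y : F | pideal k (y - x)].
Proof.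
rewrite -nbhs_entourageE; exists [set xy | pideal k (xy.1 - xy.2)].
  by apply/padic_entourageE; exists k.
by move=> y /xsectionP /= h; rewrite -opprB; apply/pidealN.
Qed.

Lemma nbhs_lattice N (g : 'M[F]_N) (k : int) :
  nbhs g [set h : 'M[F]_N | lattice (fun _ _ => k) (h - g)].
Proof.
exists (fun a b => [set y : F | pideal k (y - g a b)]) => [a b|h hh a b].
  exact: nbhs_pideal.
by rewrite !mxE; apply: hh.
Qed.

Lemma closed_lattice_limit N (S : set 'M[F]_N) :
  (forall g, (forall k : int, exists2 h, S h & lattice (fun _ _ => k) (h - g)) -> S g) ->
  closed S.
Proof.
move=> hS g cg; apply: hS => k.
by have [h [Sh hh]] := cg _ (nbhs_lattice g k); exists h.
Qed.

Lemma latticeM_const m n p (k l : int) (A : 'M[F]_(m, n)) (B : 'M[F]_(n, p)) :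
  lattice (fun _ _ => k) A -> lattice (fun _ _ => l) B ->
  lattice (fun _ _ => k + l) (A *m B).
Proof. by apply: latticeM => *; apply: lexx. Qed.

Variable n : nat.
Local Notation M := 'M[F]_(n + n).

Lemma lattice_sp_adj (k : int) (A : M) :
  lattice (fun _ _ => k) A -> lattice (fun _ _ => k) (sp_adj A).
Proof. by move=> kA a b; rewrite mxE; apply/pideal_signM. Qed.

Lemma Sp_lattice_limit (g : M) :
  (forall k : int, exists2 h, Sp h & lattice (fun _ _ => k) (h - g)) -> Sp g.
Proof.
move=> hg; apply/SpP/eqP; rewrite -subr_eq0.
apply/eqP/lattice_all_eq0 => k; have [c c0 gc] := lattice_bounded g.
have [h /SpP hS hk] := hg (`|k| - c); set d := h - g in hk.
have hc : lattice (fun _ _ => c) h.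
  by rewrite -[h](subrK g); apply: latticeD gc; apply: lattice_le hk => a b; lia.
have -> : sp_adj g *m g - 1%:M = - (sp_adj d *m h + sp_adj g *m d).
  have eh : sp_adj h = sp_adj d + sp_adj g by rewrite -sp_adjD subrK.
  by rewrite -hS [in LHS]eh mulmxDl [sp_adj g *m d]mulmxBr addrA opprB.
have hdg : lattice (fun _ _ => k) (sp_adj d *m h + sp_adj g *m d).
  apply: latticeD.
    by apply: lattice_le (latticeM_const (lattice_sp_adj hk) hc) => a b; lia.
  by apply: lattice_le (latticeM_const (lattice_sp_adj gc) hk) => a b; lia.
by move=> a b; rewrite mxE; apply/pidealN/hdg.
Qed.

Lemma Uni_closed : closed (@Uni F n).
Proof.
apply: closed_lattice_limit => g hg.
have entry a b (z : F) : (forall h, Uni h -> h a b = z) -> g a b = z.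
  move=> hz; apply/eqP; rewrite -subr_eq0; apply/eqP/pideal_all_eq0 => k.
  by have [h /hz <- hk] := hg k; have := hk a b; rewrite !mxE -opprB => /pidealN.
apply/UniP; split.
  by apply: Sp_lattice_limit => k; have [h /Uni_Sp] := hg k; exists h.
split=> [|a]; last by apply: entry => h /UniP[_ []].
apply/supportedP => a b nab; apply: entry => h /UniP[_ [/supportedP uh _]].
exact: uh.
Qed.

End Topology.

Section Transversals.
Variables (R : comUnitRingType) (N : nat).
Local Notation M := 'M[R]_N.
Implicit Types (x y g u : M) (r s : seq M) (G H K : mxgroup R N).

Definition left_coset (H : set M) x : set M := [set g | H (invmx x *m g)].

Definition inequivalent (H : set M) r :=
  uniq r /\ forall x y, x \in r -> y \in r -> H (invmx x *m y) -> x = y.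

Definition transversal (G H : set M) r := [/\ inequivalent H r,
  forall x, x \in r -> G x &
  forall g, G g -> exists2 x, x \in r & H (invmx x *m g)].

Lemma left_coset_meet H x y g : x \in unitmx -> y \in unitmx ->
  left_coset H x g -> left_coset H y g -> H (invmx x *m y).
Proof.
move=> ux uy hx hy; have /andP[_ ug] : (invmx x \in unitmx) && (g \in unitmx).
  by rewrite -unitmx_mul (mxg_unit hx).
have -> : invmx x *m y = (invmx x *m g) *m invmx (invmx y *m g).
  by rewrite invmxM ?unitmx_inv // invmxK mulmxA mulmxK.
exact: mxgM hx (mxgV hy).
Qed.

Lemma transversal_map G H r phi :
  (forall x, G x -> G (phi x)) ->
  (forall x y, G x -> G y -> H (invmx (phi x) *m phi y) -> H (invmx x *m y)) ->
  (forall x y, G x -> G y -> H (invmx x *m y) -> H (invmx (phi x) *m phi y)) ->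
  (forall g, G g -> exists2 x, G x & H (invmx (phi x) *m g)) ->
  transversal G H r -> transversal G H (map phi r).
Proof.
move=> phiG phi_inj phi_H phi_surj [[ur inj] rG cover]; split; last first.
- move=> g /phi_surj[x xG hx]; have [y yr hy] := cover x xG.
  exists (phi y); first exact: map_f.
  have := mxgM (phi_H y x (rG y yr) xG hy) hx.
  by rewrite mulmxA mulmxK // (mxg_unit (phiG x xG)).
- by move=> _ /mapP[x xr ->]; apply/phiG/rG.
have inj' x y : x \in r -> y \in r -> H (invmx (phi x) *m phi y) -> x = y.
  by move=> xr yr h; apply: inj => //; apply: phi_inj h; apply: rG.
split=> [|_ _ /mapP[x xr ->] /mapP[y yr ->] h]; last by rewrite (inj' x y).
rewrite map_inj_in_uniq // => x y xr yr e; apply: inj' => //.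
by rewrite e mulVmx ?(mxg_unit (phiG _ (rG y yr))) //; apply: mxg1.
Qed.

Lemma transversal_mull G H r u : G u ->
  transversal G H r -> transversal G H [seq u *m x | x <- r].
Proof.
move=> uG; have uu := mxg_unit uG.
have uK x y : G x -> invmx (u *m x) *m (u *m y) = invmx x *m y.
  by move=> xG; rewrite invmxM ?(mxg_unit xG) // !mulmxA mulmxKV.
apply: transversal_map => [x xG|x y xG _|x y xG _|g gG].
- exact: mxgM.
- by rewrite uK.
- by rewrite uK.
- exists (invmx u *m g); first exact: mxgM (mxgV uG) gG.
  rewrite mulKVmx // mulVmx ?(mxg_unit gG) //; exact: mxg1.
Qed.

Lemma transversal_tower G H K r s : H `<=` G -> K `<=` H ->
  transversal G H r -> transversal H K s ->
  transversal G K [seq x *m y | x <- r, y <- s].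
Proof.
move=> HG KH [[ur rinj] rG rcov] [[us sinj] sH scov].
have [rU sU] : (forall x, x \in r -> x \in unitmx) /\ (forall y, y \in s -> y \in unitmx).
  by split=> x; [move/rG/mxg_unit|move/sH/mxg_unit].
have inj x y x' y' : x \in r -> x' \in r -> y \in s -> y' \in s ->
    K (invmx (x *m y) *m (x' *m y')) -> x = x' /\ y = y'.
  move=> xr xr' ys ys'; rewrite (invmxM (rU _ xr) (sU _ ys)) => h.
  have ex : x = x'.
    apply: rinj => //.
    have -> : invmx x *m x' = y *m (invmx y *m invmx x *m (x' *m y')) *m invmx y'.
      by rewrite !mulmxA mulmxV ?sU // mul1mx mulmxK ?sU.
    by apply: mxgM (mxgV (sH _ ys')); apply: mxgM (sH _ ys) (KH _ h).
  split=> //; apply: sinj => //; move: h.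
  by rewrite -ex !mulmxA mulmxKV ?rU.
split; last 1 first.
- move=> g /rcov[x xr /scov[y ys hy]]; exists (x *m y).
    by apply/allpairsP; exists (x, y).
  by rewrite (invmxM (rU _ xr) (sU _ ys)) -mulmxA.
- split=> [|_ _ /allpairsP[[x y] /= [xr ys ->]] /allpairsP[[x' y'] /= [xr' ys' ->]] h].
    apply: allpairs_uniq => // -[x y] [x' y'] /allpairsP[[? ?] /= [xr ys [-> ->]]].
    move=> /allpairsP[[? ?] /= [xr' ys' [-> ->]]] e.
    have [] := inj _ _ _ _ xr xr' ys ys'; last by move=> -> ->.
    by rewrite e mulVmx ?unitmx_mul ?(rU _ xr') ?(sU _ ys') //; apply: mxg1.
  by have [-> ->] := inj _ _ _ _ xr xr' ys ys' h.
- by move=> _ /allpairsP[[x y] /= [xr ys ->]]; apply: mxgM (rG _ xr) (HG _ (sH _ ys)).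
Qed.

End Transversals.

Section HaarMeasureOfCosets.
Variables (R : realType) (F : padicFieldType) (n : nat).
Local Notation M := 'M[F]_(n + n).
Variables (G : mxgroup F (n + n)) (mu : {measure set (borel_mx F n) -> \bar R}).
Hypotheses (GSp : G `<=` @Sp F n) (Gclosed : closed (G : set M)).
Hypothesis hmu : haar_measure G mu.
Implicit Types (x y g : M) (r : seq M) (H K : mxgroup F (n + n)).

Definition open_subgroup (H : set M) :=
  H `<=` G /\ exists C, G `&` Kgrp C `<=` H.

Lemma right_invariant_relatively_open C (A : set M) : A `<=` G ->
  (forall x y, A x -> (G `&` Kgrp C) y -> A (x *m y)) ->
  exists2 O : set M, open O & A = O `&` G.
Proof.
move=> AG AK; exists (~` (G : set M) `|` A)°; first exact: open_interior.
apply/seteqP; split=> x; last by move=> [/interior_subset[]].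
move=> Ax; have Gx := AG x Ax; split=> //.
have [c _ xc] := lattice_bounded (invmx x).
apply: filterS (nbhs_lattice x (C%:Z - c)) => h hh.
have [Gh|] := pselect (G h); last by left.
right; rewrite -[h](mulKVmx (mxg_unit Gx)); apply: AK => //.
have Gy : G (invmx x *m h) := mxgM (mxgV Gx) Gh.
split=> //; split; first exact: GSp.
suff : lattice (fun _ _ => C%:Z) (invmx x *m h - 1%:M) by [].
rewrite -(mulVmx (mxg_unit Gx)) -mulmxBr.
by apply: lattice_le (latticeM_const xc hh) => a b; lia.
Qed.

Lemma measurable_closed (A : set M) : closed A -> measurable (A : set (borel_mx F n)).
Proof.
move=> cA; rewrite -[X in measurable X]setCK; apply: measurableC.
by apply: sub_sigma_algebra; apply: closed_openC.
Qed.

Lemma left_coset_relatively_open H x : open_subgroup H -> G x ->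
  exists2 O : set M, open O & left_coset H x = O `&` G.
Proof.
move=> [HG [C CH]] Gx; apply: (@right_invariant_relatively_open C) => [g|g k].
  by move/HG=> h; rewrite -[g](mulKVmx (mxg_unit Gx)); apply: mxgM.
by rewrite /left_coset /= mulmxA => hg /CH; apply: mxgM.
Qed.

Lemma measurable_left_coset H x : open_subgroup H -> G x ->
  measurable (left_coset H x : set (borel_mx F n)).
Proof.
move=> oH /(left_coset_relatively_open oH)[D oD ->].
apply: measurableI; last exact: measurable_closed.
exact: sub_sigma_algebra.
Qed.

Lemma left_coset1 (H : set M) : left_coset H 1%:M = H.
Proof. by apply/seteqP; split=> g; rewrite /left_coset /= invmx1 mul1mx. Qed.

Lemma measurable_open_subgroup H : open_subgroup H ->
  measurable (H : set (borel_mx F n)).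
Proof.
move=> oH; rewrite -[X in measurable X]left_coset1.
exact: measurable_left_coset (mxg1 G).
Qed.

Lemma mu_left_coset H x : open_subgroup H -> G x -> mu (left_coset H x) = mu H.
Proof.
move=> oH Gx; rewrite -(haar_invariant hmu Gx (measurable_open_subgroup oH)).
have ux := mxg_unit Gx; congr (mu _); apply/seteqP; split=> g.
  by move=> hg; exists (invmx x *m g); rewrite ?mulKVmx.
by move=> [h hh <-]; rewrite /left_coset /= mulKmx.
Qed.

Lemma mu_open_subgroup_gt0 H : open_subgroup H -> (0 < mu H)%E.
Proof.
move=> oH; have [D oD eH] := left_coset_relatively_open oH (mxg1 G).
rewrite left_coset1 in eH; rewrite eH; apply: (haar_open hmu oD).
by rewrite -eH; exists 1%:M; apply: mxg1.
Qed.

Lemma mu_left_cosets H r : open_subgroup H -> inequivalent H r ->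
  (forall x, x \in r -> G x) ->
  let A := \bigcup_(x in [set` r]) left_coset H x in
  measurable (A : set (borel_mx F n)) /\ mu A = ((size r)%:R%:E * mu H)%E.
Proof.
move=> oH [ur inj] rG A.
have mA x : [set` r] x -> measurable (left_coset H x : set (borel_mx F n)).
  by move=> /rG; apply: measurable_left_coset.
split; first exact: fin_bigcup_measurable.
have tA : trivIset [set` r] (left_coset H).
  move=> x y /= xr yr [g [hx hy]]; apply: inj => //.
  by apply: left_coset_meet hx hy; apply/mxg_unit/rG.
rewrite measure_fin_bigcup -?fsbig_seq //; last exact: finite_seq.
rewrite (eq_big_seq (fun=> mu H)) => [|x xr]; last exact/mu_left_coset/rG.
by rewrite big_const_seq count_predT iter_addr_0 mule_natl.
Qed.

Lemma fine_mu_open_subgroup_gt0 H : open_subgroup H -> (mu H < +oo)%E ->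
  0 < fine (mu H).
Proof.
by move=> oH fin; rewrite fine_gt0 // mu_open_subgroup_gt0.
Qed.

Lemma mu_open_subgroup_lty H K : open_subgroup H -> open_subgroup K ->
  H `<=` K -> (mu K < +oo)%E -> (mu H < +oo)%E.
Proof.
move=> oH oK HK; apply: le_lt_trans.
by apply: le_measure => //; rewrite inE; apply: measurable_open_subgroup.
Qed.

Lemma inequivalent_size_bound H K r : open_subgroup H -> open_subgroup K ->
  H `<=` K -> (mu K < +oo)%E -> inequivalent H r -> (forall x, x \in r -> K x) ->
  (size r <= Num.trunc (fine (mu K) / fine (mu H)))%N.
Proof.
move=> oH oK HK fin rH rK; have KG := oK.1.
have Hlty := mu_open_subgroup_lty oH oK HK fin.
have H0 := fine_mu_open_subgroup_gt0 oH Hlty.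
have [Hfin Kfin] : mu H \is a fin_num /\ mu K \is a fin_num.
  by rewrite !ge0_fin_numE.
have [|mA eA] := mu_left_cosets oH rH; first by move=> x /rK/KG.
have : (mu (\bigcup_(x in [set` r]) left_coset H x) <= mu K)%E.
  apply: le_measure; rewrite ?inE //; first exact: measurable_open_subgroup.
  move=> g [x /= /rK Kx /HK Kg].
  by rewrite -[g](mulKVmx (mxg_unit Kx)); apply: mxgM.
rewrite eA -(fineK Hfin) -(fineK Kfin) -EFinM lee_fin => le.
by rewrite truncn_ge_nat ?divr_ge0 ?fine_ge0 // ler_pdivlMr.
Qed.

Lemma inequivalent_cons H r g : g \in unitmx -> (forall x, x \in r -> x \in unitmx) ->
  (forall x, x \in r -> ~ H (invmx x *m g)) ->
  inequivalent H r -> inequivalent H (g :: r).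
Proof.
move=> ug ur ng [uniq_r inj]; split.
  rewrite /= uniq_r andbT; apply/negP => /ng; apply.
  by rewrite mulVmx //; apply: mxg1.
move=> x y; rewrite !inE => /orP[/eqP->|xr] /orP[/eqP->|yr] // h.
- by case: (ng y yr); move: (mxgV h); rewrite invmxM ?unitmx_inv ?(ur y yr) // invmxK.
- by case: (ng x xr).
- exact: inj.
Qed.

Lemma transversal_exists H K : open_subgroup H -> open_subgroup K -> H `<=` K ->
  (mu K < +oo)%E -> exists r, transversal K H r.
Proof.
move=> oH oK HK fin.
pose Q q := `[< exists r, [/\ size r = q, inequivalent H r & forall x, x \in r -> K x] >].
have exQ : exists q, Q q.
  by exists 0%N; apply/asboolP; exists [::]; split => //; split=> // x y.
have boundQ q : Q q -> (q <= Num.trunc (fine (mu K) / fine (mu H)))%N.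
  by move=> /asboolP[r [<- rH rK]]; apply: inequivalent_size_bound rH rK.
case: (ex_maxnP exQ boundQ) => q /asboolP[r [sz rH rK]] qmax.
exists r; split=> // g Kg; apply: contrapT => uncovered.
suff : (q.+1 <= q)%N by rewrite ltnn.
apply: qmax; apply/asboolP; exists (g :: r); split; first by rewrite /= sz.
  apply: inequivalent_cons rH; first exact: mxg_unit Kg.
    by move=> x /rK/mxg_unit.
  by move=> x xr hx; apply: uncovered; exists x.
by move=> x; rewrite inE => /orP[/eqP->|/rK].
Qed.

Section AverageOverCosets.
Variables (V : lmodType R[i]) (H K : mxgroup F (n + n)) (r : seq M) (f : M -> V).
Hypotheses (oH : open_subgroup H) (oK : open_subgroup K) (HK : H `<=` K).
Hypotheses (fin : (mu K < +oo)%E) (hr : transversal K H r).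
Hypothesis fH : forall x y, K x -> H y -> f (x *m y) = f x.

Lemma left_coset_invariant x g : x \in r -> left_coset H x g -> K g /\ f g = f x.
Proof.
have [_ rK _] := hr; move=> /rK Kx hx.
rewrite -[g](mulKVmx (mxg_unit Kx)); split; last exact: fH.
exact: mxgM Kx (HK hx).
Qed.

Lemma mu_union_left_cosets (P : pred M) (A : set M) :
  (forall g, A g <-> exists2 x, x \in r & P x /\ left_coset H x g) ->
  fine (mu A) = (count P r)%:R * fine (mu H).
Proof.
have [[ur inj] rK _] := hr => AE.
have rPH : inequivalent H [seq x <- r | P x].
  split=> [|x y]; first by rewrite filter_uniq.
  by rewrite !mem_filter => /andP[_ xr] /andP[_ yr]; apply: inj.
have [|_] := mu_left_cosets oH rPH.
  by move=> x; rewrite mem_filter => /andP[_ /rK]; apply: oK.1.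
have Hfin : mu H \is a fin_num.
  by rewrite ge0_fin_numE // (mu_open_subgroup_lty oH oK).
rewrite size_filter -(fineK Hfin) -EFinM.
suff -> : A = \bigcup_(x in [set` [seq x <- r | P x]]) left_coset H x by move=> ->.
apply/seteqP; split=> g.
  by move=> /AE[x xr [Px]]; exists x; rewrite //= mem_filter Px.
by move=> [x /=]; rewrite mem_filter => /andP[Px xr] hx; apply/AE; exists x.
Qed.

Lemma vintegral_left_cosets :
  vintegral mu K f = (fine (mu H))%:C%C *: \sum_(x <- r) f x.
Proof.
have [_ rK cover] := hr; rewrite /vintegral.
have -> : f @` K = [set` undup (map f r)].
  apply/seteqP; split=> z /=; rewrite mem_undup.
    move=> [g /cover[x xr hx] <-]; have [_ ->] := left_coset_invariant xr hx.
    exact: map_f.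
  by move=> /mapP[x xr ->]; exists x => //; apply: rK.
rewrite -fsbig_seq ?undup_uniq // scaler_sumr.
rewrite -(big_map f xpredT (fun z => (fine (mu H))%:C%C *: z)).
rewrite -[RHS]big_undup_iterop_count; apply: eq_bigr => z _.
rewrite (@mu_union_left_cosets (fun x => f x == z)) => [|g]; last first.
  split=> [[/cover[x xr hx] /= <-]|[x xr [/eqP <- hx]]].
    by exists x => //; have [_ ->] := left_coset_invariant xr hx.
  by have [Kg fg] := left_coset_invariant xr hx; split.
rewrite count_map Monoid.iteropE iter_addr_0 -[RHS]scaler_nat scalerA.
by rewrite rmorphM rmorph_nat.
Qed.

Lemma vintegral_mean_transversal :
  ((fine (mu K))^-1)%:C%C *: vintegral mu K f =
  ((size r)%:R^-1 : R[i]) *: \sum_(x <- r) f x.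
Proof.
have muK : fine (mu K) = (size r)%:R * fine (mu H).
  rewrite -(count_predT r); apply: mu_union_left_cosets => g.
  split=> [Kg|[x xr [_ /(left_coset_invariant xr)[]//]]].
  by have [_ _ /(_ g Kg)[x xr hx]] := hr; exists x.
have H0 := fine_mu_open_subgroup_gt0 oH (mu_open_subgroup_lty oH oK HK fin).
rewrite vintegral_left_cosets scalerA muK; congr (_ *: _).
by rewrite -rmorphM invfM mulfVK ?gt_eqF // fmorphV rmorph_nat.
Qed.

End AverageOverCosets.

End HaarMeasureOfCosets.

Section GenericCharacter.
Variables (R : realType) (F : padicFieldType) (n : nat) (psi : F -> R[i]).
Hypothesis hpsi : additive_character_of_conductor_O psi.
Local Notation M := 'M[F]_(n + n).
Implicit Types (g h u v l x : M) (i : 'I_n) (m k C : nat).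

Lemma psi_congr (x y : F) : pideal 0 (x - y) -> psi x = psi y.
Proof.
by move=> /(psi_trivial_O hpsi) h; rewrite -(subrK y x) (psiD hpsi) h mul1r.
Qed.

Lemma superdiagE g : superdiag g = \sum_(i < n) g (srow i) (scol i).
Proof. by []. Qed.

Lemma psiU_neq0 u : psiU psi u != 0.
Proof. exact: (psi_neq0 hpsi). Qed.

Lemma psiUM u v : Uni u -> Uni v -> psiU psi (u *m v) = psiU psi u * psiU psi v.
Proof.
move=> hu hv; rewrite /psiU -(psiD hpsi) !superdiagE -big_split; congr psi.
by apply: eq_bigr => i _; rewrite Uni_mul_adjacent // val_scol.
Qed.

Lemma psiU_lower g : supported >=%O g -> psiU psi g = 1.
Proof.
move=> /supportedP lg; rewrite /psiU superdiagE big1 => [|i _].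
  by apply: (psi_trivial_O hpsi); left.
by apply: lg; rewrite /= -ltNge; apply: srow_lt_scol.
Qed.

Lemma psiU_Kgrp C u : Kgrp C u -> psiU psi u = 1.
Proof.
move=> [_ uC]; apply: (psi_trivial_O hpsi); rewrite superdiagE.
apply: pideal_sum => i _; have := uC (srow i) (scol i).
by rewrite !mxE (negPf (srow_neq_scol i)) subr0; apply: pideal_le.
Qed.

Lemma psiU_howe_groupM k g h : howe_group k g -> howe_group k h ->
  psiU psi (g *m h) = psiU psi g * psiU psi h.
Proof.
move=> [_ gk] [_ hk]; rewrite /psiU -(psiD hpsi); apply: psi_congr.
have -> : superdiag (g *m h) - (superdiag g + superdiag h) =
    superdiag ((g - 1%:M) *m (h - 1%:M)).
  rewrite !superdiagE -big_split -sumrB; apply: eq_bigr => i _ /=.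
  rewrite mulmxBl mul1mx mulmxBr mulmx1 !mxE.
  by rewrite (negPf (srow_neq_scol i)) subr0; ring.
rewrite superdiagE; apply: pideal_sum => i _; rewrite mxE; apply: pideal_sum => c _.
by apply: pideal_le (pidealM (gk _ _) (hk _ _)); rewrite !howe_tiltE val_scol /=; lia.
Qed.

(* Iwahori factorization of H_k: psi_k only sees the upper unipotent factor. *)
Lemma howe_group_swap C k l x : (0 < C <= k)%N ->
  opposite (@Bor F n) l -> howe_group k l -> (@Uni F n `&` howe_group k) x ->
  exists y z, [/\ (@Uni F n `&` howe_group k) y, Kgrp C z, l *m x = y *m z &
    psiU psi y = psiU psi x].
Proof.
move=> /andP[C0 Ck] lB lk [xU xk].
have [lxS lxk] : howe_group k (l *m x) := mxgM lk xk.
have k0 : (0 < k)%N by apply: leq_trans C0 Ck.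
have [y [z [e [yU fy] [zB fz]]]] := Sp_one_plus_Uni_oppBor
  (@howe_tilt_subadditive n k) (fun a => howe_tilt_diag a k0) lxS lxk.
have yk : howe_group k y by split; first exact: Uni_Sp.
have [zS zl] := (opposite_BorP _).1 zB; have [_ ll] := (opposite_BorP _).1 lB.
have zk : howe_group k z by split.
exists y, z; split=> //; first exact: opposite_Bor_howe_group_sub Ck _ _.
rewrite -[LHS]mulr1 -(psiU_lower zl) -(psiU_howe_groupM yk zk) -e.
by rewrite (psiU_howe_groupM lk xk) (psiU_lower ll) mul1r.
Qed.

End GenericCharacter.

Section HoweVectors.
Variables (R : realType) (F : padicFieldType) (n : nat) (varpi : F).
Hypothesis hvarpi : uniformizer varpi.
Variable psi : F -> R[i].
Hypothesis hpsi : additive_character_of_conductor_O psi.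
Variable mu : {measure set (borel_mx F n) -> \bar R}.
Hypothesis hmu : haar_measure (@Uni F n) mu.
Local Notation M := 'M[F]_(n + n).
Local Notation U_ m := (@Uni F n `&` howe_group m).
Local Notation U0 C := (@Uni F n `&` @Kgrp F n C).
Implicit Types (g h x y z u l : M) (m k : nat).

Lemma UmE m : Um varpi m = U_ m.
Proof. by rewrite /Um HgrpE. Qed.

Lemma open_subgroup_howe m : open_subgroup (Uni_mxgroup F n) (U_ m).
Proof.
split; first by move=> u [].
by exists 0%N => u [uU uk]; split=> //; apply: Kgrp_Uni_sub_howe_group (conj uU uk).
Qed.

Lemma open_subgroup_Kgrp C : open_subgroup (Uni_mxgroup F n) (U0 C).
Proof. by split=> [u []|] //; exists C. Qed.

Lemma U0_sub_Um C m : U0 C `<=` U_ m.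
Proof. by move=> u uC; split; [case: uC|apply: Kgrp_Uni_sub_howe_group uC]. Qed.

Section Representation.
Variables (V : lmodType R[i]) (rho : M -> {linear V -> V}).
Hypothesis hrho : representation rho.
Variables (v : V) (C : nat).
Hypotheses (hC : (0 < C)%N) (hfix : forall g, Kgrp C g -> rho g v = v).

Local Notation howe m := (howe_vector varpi psi rho mu m v).

Lemma howe_vector_infinite m : mu (U_ m) = +oo%E -> howe m = 0.
Proof. by rewrite /howe_vector UmE => ->; rewrite /= invr0 scale0r. Qed.

Lemma howe_transversal_exists m : (mu (U_ m) < +oo)%E ->
  exists r, transversal (U_ m) (U0 C) r.
Proof.
exact: (transversal_exists (@Uni_Sp F n) (@Uni_closed F n) hmu (open_subgroup_Kgrp C)
  (open_subgroup_howe m) (@U0_sub_Um C m)).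
Qed.

Lemma howe_vector_transversal m r :
  (mu (U_ m) < +oo)%E -> transversal (U_ m) (U0 C) r ->
  howe m = ((size r)%:R^-1 : R[i]) *: \sum_(x <- r) (psiU psi x)^-1 *: rho x v.
Proof.
move=> fin hr; rewrite /howe_vector UmE.
rewrite (vintegral_mean_transversal (@Uni_Sp F n) (@Uni_closed F n) hmu
  (open_subgroup_Kgrp C) (open_subgroup_howe m) (@U0_sub_Um C m) fin hr).
  by congr (_ *: _); apply: eq_bigr => x _; rewrite psiH_psiU.
move=> x y [xU _] [yU yK]; rewrite !psiH_psiU // psiUM // (psiU_Kgrp hpsi yK) mulr1.
by rewrite (repM hrho (Uni_Sp xU) (Uni_Sp yU)) hfix.
Qed.

Lemma howe_vector_equivariant m u : U_ m u -> rho u (howe m) = psiU psi u *: howe m.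
Proof.
move=> hu; have [uU _] := hu.
have [/howe_vector_infinite ->|] := eqVneq (mu (U_ m)) +oo%E.
  by rewrite linear0 scaler0.
rewrite -ltey => fin; have [r hr] := howe_transversal_exists fin.
rewrite {2}(howe_vector_transversal fin (transversal_mull hu hr)).
rewrite (howe_vector_transversal fin hr) size_map big_map linearZ /= scalerA.
rewrite mulrC -scalerA; congr (_ *: _).
rewrite linear_sum scaler_sumr big_seq [RHS]big_seq; apply: eq_bigr => x xr.
have [xU _] : U_ m x by case: hr => _ + _; apply.
rewrite linearZ /= psiUM // scalerA invfM mulrA mulfV ?psiU_neq0 // mul1r.
by rewrite (repM hrho (Uni_Sp uU) (Uni_Sp xU)).
Qed.

Lemma transversal_lower_translate k l r : (C <= k)%N ->
  opposite (@Bor F n) l -> howe_group k l -> transversal (U_ k) (U0 C) r ->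
  exists2 phi : M -> M, transversal (U_ k) (U0 C) (map phi r) &
    forall x, U_ k x -> exists z, [/\ U_ k (phi x), Kgrp C z, l *m x = phi x *m z &
                                   psiU psi (phi x) = psiU psi x].
Proof.
move=> Ck lB lk hr; have ul := mxg_unit lk.
have hCk : (0 < C <= k)%N by rewrite hC.
have /choice[phi hphi] : forall x, exists y, U_ k x ->
    exists z, [/\ U_ k y, Kgrp C z, l *m x = y *m z & psiU psi y = psiU psi x].
  move=> x; have [xk|] := pselect (U_ k x); last by exists x.
  by have [y hy] := howe_group_swap hpsi hCk lB lk xk; exists y.
exists phi => //.
have phi_quotient x y : U_ k x -> U_ k y ->
    Kgrp C (invmx x *m y) <-> Kgrp C (invmx (phi x) *m phi y).
  move=> hx hy; have [[zx [px kx ex _]] [zy [py ky ey _]]] := (hphi x hx, hphi y hy).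
  have -> : invmx x *m y = invmx zx *m (invmx (phi x) *m phi y) *m zy.
    have exV := congr1 (@invmx F (n + n)) ex.
    rewrite !invmxM ?(mxg_unit hx) ?(mxg_unit px) ?(mxg_unit kx) // in exV.
    by rewrite -[y in LHS](mulKmx ul) ey !mulmxA exV.
  split=> [h|h]; last exact: mxgM (mxgM (mxgV kx) h) ky.
  have := mxgM (mxgM kx h) (mxgV ky).
  by rewrite !mulmxA mulmxV ?(mxg_unit kx) // mul1mx mulmxK ?(mxg_unit ky).
apply: transversal_map hr => [x /hphi[z []] //|x y hx hy [_ h]|x y hx hy [_ h]|g hg].
- by split; [apply: mxgM (mxgV hx.1) hy.1|apply/(phi_quotient _ _ hx hy)].
- have [[zx [px _ _ _]] [zy [py _ _ _]]] := (hphi x hx, hphi y hy).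
  by split; [apply: mxgM (mxgV px.1) py.1|apply/(phi_quotient _ _ hx hy)].
- have [y [z [hy kz e _]]] := howe_group_swap hpsi hCk (mxgV lB) (mxgV lk) hg.
  exists y => //; have [zy [py ky ey _]] := hphi y hy.
  split; first exact: mxgM (mxgV py.1) hg.1.
  rewrite -[g](mulKVmx ul) e [l *m _]mulmxA ey -!mulmxA mulKmx ?(mxg_unit py) //.
  exact: mxgM.
Qed.

Lemma howe_vector_lower k l : (C <= k)%N -> opposite (@Bor F n) l -> howe_group k l ->
  rho l (howe k) = howe k.
Proof.
move=> Ck lB lk.
have [/howe_vector_infinite ->|] := eqVneq (mu (U_ k)) +oo%E; first by rewrite linear0.
rewrite -ltey => fin; have [r hr] := howe_transversal_exists fin.
have [phi hr' hphi] := transversal_lower_translate Ck lB lk hr.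
rewrite {2}(howe_vector_transversal fin hr') (howe_vector_transversal fin hr).
rewrite size_map big_map.
rewrite linearZ; congr (_ *: _); rewrite linear_sum big_seq [RHS]big_seq.
apply: eq_bigr => x xr; have hx : U_ k x by case: hr => _ + _; apply.
have [z [hy kz e ep]] := hphi x hx; rewrite linearZ /= ep; congr (_ *: _).
rewrite -(repM hrho lk.1 (Uni_Sp hx.1)) e.
by rewrite (repM hrho (Uni_Sp hy.1) kz.1) hfix.
Qed.

Lemma howe_vector_average k m r : (k <= m)%N -> (mu (U_ m) < +oo)%E ->
  transversal (U_ m) (U_ k) r ->
  howe m = ((size r)%:R^-1 : R[i]) *: \sum_(x <- r) (psiU psi x)^-1 *: rho x (howe k).
Proof.
move=> km fin hr; have sub := @howe_group_Uni_sub F n k m km.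
have fink : (mu (U_ k) < +oo)%E.
  exact: (mu_open_subgroup_lty (@Uni_Sp F n) (@Uni_closed F n)
    (open_subgroup_howe k) (open_subgroup_howe m) sub fin).
have [s hs] := howe_transversal_exists fink.
have hrs := transversal_tower sub (@U0_sub_Um C k) hr hs.
rewrite (howe_vector_transversal fin hrs) (howe_vector_transversal fink hs) size_allpairs.
rewrite natrM invfM -scalerA; congr (_ *: _).
rewrite big_allpairs_dep scaler_sumr big_seq [RHS]big_seq; apply: eq_bigr => x xr.
have [xU _] : U_ m x by case: hr => _ + _; apply.
rewrite linearZ /= scalerA [in RHS]mulrC -scalerA; congr (_ *: _).
rewrite linear_sum scaler_sumr big_seq [RHS]big_seq; apply: eq_bigr => y ys.
have [yU _] : U_ k y by case: hs => _ + _; apply.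
rewrite psiUM // invfM -scalerA; congr (_ *: _); rewrite linearZ; congr (_ *: _).
by rewrite (repM hrho (Uni_Sp xU) (Uni_Sp yU)).
Qed.

End Representation.

End HoweVectors.

Section RootSpaces.
Variables (F : padicFieldType) (n : nat) (varpi : F).
Hypothesis hvarpi : uniformizer varpi.
Local Notation M := 'M[F]_(n + n).
Local Notation I := 'I_(n + n).
Local Notation chi := {ffun 'I_n -> int}.
Implicit Types (X x t u : M) (a b c : I) (g d : chi) (e : I -> int) (i : 'I_n).

Definition cochar_pairing e g : int := \sum_(i < n) e (lshift n i) * g i.

Lemma char_eval_varpi_diag e g :
  char_eval g (varpi_diag varpi e) = varpi ^ cochar_pairing e g.
Proof.
have [v0 _] := hvarpi; rewrite /char_eval /cochar_pairing.
elim/big_rec2: _ => [|i y z _ ->]; first by rewrite expr0z.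
by rewrite expfzDr // varpi_diagE eqxx mulr1n exprz_exp.
Qed.

Lemma cochar_pairingD e g d :
  cochar_pairing e (g + d) = cochar_pairing e g + cochar_pairing e d.
Proof.
by rewrite /cochar_pairing -big_split; apply: eq_bigr => i _; rewrite ffunE mulrDr.
Qed.

Lemma cochar_pairing0 e : cochar_pairing e 0 = 0.
Proof. by rewrite /cochar_pairing big1 // => i _; rewrite ffunE mulr0. Qed.

Lemma cochar_pairingN e g : cochar_pairing e (- g) = - cochar_pairing e g.
Proof. by apply/eqP; rewrite -addr_eq0 -cochar_pairingD addNr cochar_pairing0. Qed.

Lemma cochar_pairingMn e g k : cochar_pairing e (g *+ k) = cochar_pairing e g *+ k.
Proof.
elim: k => [|k IH]; first by rewrite !mulr0n cochar_pairing0.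
by rewrite !mulrS cochar_pairingD IH.
Qed.

Lemma root_space_entry e g X a b : (forall c, e c + e (rev_ord c) = 0) ->
  root_space g X -> X a b != 0 -> e a - e b = cochar_pairing e g.
Proof.
move=> he [_ gX] nz; apply: (uniformizer_expz_inj hvarpi); apply: (mulIf nz) => /=.
rewrite -varpi_diag_conjE // -char_eval_varpi_diag (gX _ (Tor_varpi_diag hvarpi he)).
by rewrite mxE.
Qed.

Definition bump_cochar c a : int := (a == c)%:Z - (a == rev_ord c)%:Z.

Lemma bump_cochar_rev c a : bump_cochar c a + bump_cochar c (rev_ord a) = 0.
Proof. by rewrite /bump_cochar (inj_eq rev_ord_inj) eq_rev_ord addrC subrKA subrr. Qed.

Lemma root_space_diag g X a : g != 0 -> root_space g X -> X a a = 0.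
Proof.
move=> g0 gX; apply: contraNeq g0 => nz; apply/eqP/ffunP => i; rewrite ffunE.
have := root_space_entry (bump_cochar_rev (lshift n i)) gX nz; rewrite subrr => ->.
rewrite /cochar_pairing (bigD1 i) //= /bump_cochar eqxx eq_sym rev_ord_neq subr0 mul1r.
rewrite big1 ?addr0 // => j ji; rewrite (inj_eq (@lshift_inj _ _)) (negPf ji).
rewrite [_ == _](_ : _ = false) ?mul0r // -val_eqE /=.
by have := ltn_ord i; have := ltn_ord j; lia.
Qed.

Lemma root_space_sqr0 g X : g != 0 -> root_space g X -> X *m X = 0.
Proof.
move=> g0 gX; apply/matrixP => a b; rewrite mxE [RHS]mxE big1 // => c _.
apply/eqP; apply: contraT; rewrite mulf_eq0 negb_or => /andP[ac cb].
have [na nb] : (a == c) = false /\ (b == c) = false.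
  split; apply/negbTE; [move: ac|move: cb]; apply: contraNneq => ->;
    by rewrite (root_space_diag _ g0 gX).
have := root_space_entry (bump_cochar_rev c) gX ac.
rewrite -(root_space_entry (bump_cochar_rev c) gX cb).
rewrite /bump_cochar eqxx na nb [c == _]eq_sym rev_ord_neq.
by case: (a == rev_ord c); case: (b == rev_ord c).
Qed.

Lemma dmx_weight_rev a : dmx_weight (n := n) 1 a + dmx_weight 1 (rev_ord a) = 0.
Proof. by rewrite /dmx_weight /= !mulr1; have := ltn_ord a; lia. Qed.

Definition height g : int := cochar_pairing (dmx_weight 1) g.

Lemma height_simple_root i : height (simple_root i) = - 2.
Proof.
rewrite /height /cochar_pairing; have [hi|hi] := ltnP i.+1 n.
  pose j := Ordinal hi; have ji : j != i by rewrite -val_eqE /=; lia.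
  rewrite (bigD1 i) //= (bigD1 j) //= big1 => [|k /andP[ki kj]].
    rewrite !ffunE hi -!val_eqE /= !eqxx ltn_eqF // gtn_eqF //.
    by rewrite /dmx_weight /=; lia.
  rewrite ffunE hi (negPf ki) (_ : (k == i.+1 :> nat) = false) ?subrr ?mulr0 //.
  by move: kj; rewrite -val_eqE /= => /negPf.
rewrite (bigD1 i) //= ffunE ltnNge hi /= eqxx big1 => [|k ki].
  by rewrite /dmx_weight /=; have := ltn_ord i; lia.
by rewrite ffunE ltnNge hi (negPf ki) !mulr0.
Qed.

Lemma pos_root_height g : pos_root F g -> height g < 0.
Proof.
move=> [[g0 _] [c eg]].
have -> : height g = - (\sum_(i < n) 2 * (c i)%:Z).
  rewrite -sumrN eg /height; elim/big_rec2: _ => [|i y z _ <-].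
    exact: cochar_pairing0.
  rewrite cochar_pairingD cochar_pairingMn [cochar_pairing _ _]height_simple_root.
  by rewrite -mulr_natr natz; lia.
have [i ci] : exists i, (0 < c i)%N.
  apply/existsP; apply: contraNT g0; rewrite negb_exists => /forallP c0.
  by rewrite eg big1 // => i _; have := c0 i; rewrite -eqn0Ngt => /eqP ->.
rewrite oppr_lt0 (bigD1 i) //=; apply: ltr_pwDl; first by lia.
by apply: sumr_ge0 => j _; lia.
Qed.

Lemma pos_root_space_upper g X a b :
  pos_root F g -> root_space g X -> X a b != 0 -> (a < b)%O.
Proof.
move=> /pos_root_height + gX nz; rewrite /height.
rewrite -(root_space_entry dmx_weight_rev gX nz) ltEord /dmx_weight; lia.
Qed.

Lemma neg_root_space_lower g X a b :
  pos_root F g -> root_space (- g) X -> X a b != 0 -> (b < a)%O.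
Proof.
move=> /pos_root_height + gX nz; rewrite /height.
rewrite -[cochar_pairing _ _]opprK -cochar_pairingN.
rewrite -(root_space_entry dmx_weight_rev gX nz) ltEord /dmx_weight; lia.
Qed.

Lemma Sp_1D_root_space g X : g != 0 -> root_space g X -> Sp (1%:M + X).
Proof.
move=> g0 gX; apply: Sp_1D_sp_adjN; first by apply/sp_lieP; case: gX.
exact: root_space_sqr0 gX.
Qed.

Lemma Uni_1D_root_space g X : pos_root F g -> root_space g X -> Uni (1%:M + X).
Proof.
move=> pg gX; have [[g0 _] _] := pg.
apply/UniP; split; first exact: Sp_1D_root_space gX.
have sX a b : X a b != 0 -> (a < b)%O := pos_root_space_upper pg gX.
have [|sE dE] := unisupported_1D sX; first by move=> a b /lt_eqF ->.
by split=> //; apply: supported_sub sE => a b; rewrite le_eqVlt.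
Qed.

Lemma opposite_Uni_1D_root_space g X : pos_root F g -> root_space (- g) X ->
  opposite (@Uni F n) (1%:M + X).
Proof.
move=> pg gX; have [[g0 _] _] := pg; apply/opposite_UniP.
split; first by apply: Sp_1D_root_space gX; rewrite oppr_eq0.
have sX a b : X a b != 0 -> (b < a)%O := neg_root_space_lower pg gX.
have [|sE dE] := unisupported_1D sX; first by move=> a b /gt_eqF ->.
by split=> //; apply: supported_sub sE => a b; rewrite /= le_eqVlt eq_sym.
Qed.

Lemma root_space_conj_word_mx s g d X : weyl_act (@weyl_word F n s) g d ->
  root_space g X -> root_space d (word_mx F s *m X *m invmx (word_mx F s)).
Proof.
set x := word_mx F s => act [/sp_lieP lX gX].
have xS : Sp x := Sp_word_mx F s; have ux := mxg_unit xS.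
split=> [|t tT].
  apply/sp_lieP; rewrite !sp_adjM lX -(Sp_invE xS) -(Sp_invE (mxgV xS)) invmxK.
  by rewrite mulNmx mulmxN mulmxA.
have ut := mxg_unit tT; rewrite (act x t (word_mx_in_weyl_word F s) tT).
have := gX _ (Tor_conjV_word_mx s tT); rewrite -/x => e.
rewrite scalemxAl scalemxAr -e !invmxM ?unitmx_mul ?unitmx_inv ?ux // invmxK.
by rewrite !mulmxA mulmxV // mul1mx !mulmxK // mulmxKV.
Qed.

Lemma Uminus_Uni_conj_opposite (s : seq 'I_n) u : Uminus (weyl_word s) u ->
  Uni u /\ opposite (@Uni F n) (word_mx F s *m u *m invmx (word_mx F s)).
Proof.
set x := word_mx F s; have ux : x \in unitmx := word_mx_unit F s.
move=> [r [y [_ er hy ->]]].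
pose P u := Uni u /\ opposite (@Uni F n) (x *m u *m invmx x).
rewrite -/(P _) big_seq; elim/big_ind: _ => [|u1 u2 [U1 O1] [U2 O2]|g gr].
- by split; rewrite ?mxconj1 //; apply: mxg1.
- by split; [exact: mxgM|rewrite mxconjM //; apply: mxgM].
have hg : inv_roots (@weyl_word F n s) g by rewrite -er.
have [X gX <-] := hy g hg; have [pg [d pd act]] := hg.
split; first exact: Uni_1D_root_space gX.
rewrite mulmxDr mulmx1 mulmxDl mulmxV //.
exact: opposite_Uni_1D_root_space pd (root_space_conj_word_mx act gX).
Qed.

Lemma Uminus_splits_howe_group (m : nat) (s : seq 'I_n) u :
  (0 < m)%N -> Uminus (weyl_word s) u ->
  splits s (@Uni F n `&` howe_group m) u -> howe_group m u.
Proof.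
move=> m0 /Uminus_Uni_conj_opposite[uU xuO]; set x := word_mx F s in xuO *.
have xS : Sp x := Sp_word_mx F s; have ux := mxg_unit xS.
have sx : signed_perm (word_perm s) x := signed_perm_word_mx F s.
move=> [u' [h [eu _ xuU [_ [hS hm]]]]]; split; first exact: Uni_Sp.
pose f a b := howe_tilt m (word_perm s a) (word_perm s b).
have ff : subadditive f by move=> a c b; apply: howe_tilt_subadditive.
have f1 a : 1 <= f a a by apply: howe_tilt_diag.
have xhS : Sp (x *m h *m invmx x) by apply: mxgM (mxgV xS); apply: mxgM xS hS.
have [b [l [e bB [lO fl]]]] := Sp_one_plus_Bor_oppUni ff f1 xhS (one_plus_conj sx hm).
have xuE : x *m u *m invmx x = l.
  apply: (@Bor_opposite_Uni_inj _ _ 1%:M (x *m u' *m invmx x *m b)) => //.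
  - exact: mxg1.
  - exact: mxgM (Uni_Bor xuU) bB.
  - by rewrite mul1mx eu mxconjM // -[RHS]mulmxA -e.
have := one_plus_conj (signed_permV sx) fl.
rewrite invmxK -xuE mxconjK //.
by apply: one_plus_le => a c; rewrite /f !permKV.
Qed.

End RootSpaces.

Section Levels.
Variables (len : nat) (a : nat -> nat).
Hypothesis ha : forall j, (0 < j <= len)%N -> (j + a j.-1 <= a j)%N.

Lemma level_mono i j : (i <= j <= len)%N -> (a i <= a j)%N.
Proof.
elim: j => [|j IH] /andP[ij jl]; first by have -> : i = 0%N by lia.
have [->//|ne] := eqVneq i j.+1.
have : (a i <= a j)%N by apply: IH; lia.
by have := @ha j.+1 jl; rewrite /=; lia.
Qed.

Lemma level_bound_mono C i j m : (i <= j <= len)%N ->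
  (4 ^ a j * C <= m)%N -> (4 ^ a i * C <= m)%N.
Proof.
move=> ijl; apply: leq_trans.
by rewrite leq_mul2r leq_exp2l // level_mono ?orbT.
Qed.

Lemma level_step C j m : (0 < j <= len)%N -> (4 ^ a j * C <= m)%N ->
  (3 * (4 ^ a j.-1 * C) <= m)%N.
Proof.
move=> hj; apply: leq_trans; have := ha hj => aj.
have : (4 ^ (a j.-1).+1 <= 4 ^ a j)%N by rewrite leq_exp2l //; lia.
by rewrite expnS; nia.
Qed.

End Levels.

Section Comparison.
Variables (R : realType) (F : padicFieldType) (n : nat) (varpi : F).
Hypothesis hvarpi : uniformizer varpi.
Variable psi : F -> R[i].
Hypothesis hpsi : additive_character_of_conductor_O psi.
Variable mu : {measure set (borel_mx F n) -> \bar R}.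
Hypothesis hmu : haar_measure (@Uni F n) mu.
Variables (V V' : lmodType R[i]).
Variables (rho : 'M[F]_(n + n) -> {linear V -> V}).
Variables (rho' : 'M[F]_(n + n) -> {linear V' -> V'}).
Hypotheses (hrho : representation rho) (hrho' : representation rho').
Variables (lambda : {scalar V}) (lambda' : {scalar V'}).
Hypothesis hlambda : whittaker_functional psi rho lambda.
Hypothesis hlambda' : whittaker_functional psi rho' lambda'.
Variables (v : V) (v' : V') (C : nat).
Hypothesis hC : (0 < C)%N.
Hypothesis hfix : forall k, Kgrp C k -> rho k v = v.
Hypothesis hfix' : forall k, Kgrp C k -> rho' k v' = v'.

Local Notation M := 'M[F]_(n + n).
Local Notation I := 'I_(n + n).
Local Notation U_ m := (@Uni F n `&` howe_group m).
Implicit Types (g x u t l : M) (s : seq 'I_n) (k m : nat).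

Definition agree k g :=
  whittaker rho lambda (howe_vector varpi psi rho mu k v) g =
  whittaker rho' lambda' (howe_vector varpi psi rho' mu k v') g.

Lemma agree_Uni_mull k u g : Uni u -> Sp g -> agree k g -> agree k (u *m g).
Proof.
rewrite /agree /whittaker => hu gS e; have uS := Uni_Sp hu.
by rewrite (repM hrho) // (repM hrho') // hlambda.2 // hlambda'.2 // e.
Qed.

Lemma agree_Um_mulr m u g : U_ m u -> Sp g -> agree m g -> agree m (g *m u).
Proof.
rewrite /agree /whittaker => hu gS e; have uS := Uni_Sp hu.1.
rewrite (repM hrho) // (repM hrho') //.
rewrite (howe_vector_equivariant hvarpi hpsi hmu hrho hfix hu).
rewrite (howe_vector_equivariant hvarpi hpsi hmu hrho' hfix' hu).
move: (howe_vector _ _ rho _ _ _) (howe_vector _ _ rho' _ _ _) e => z z' e.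
by rewrite !linearZ /= e.
Qed.

Lemma agree_lower_mulr k l g : (C <= k)%N -> opposite (@Bor F n) l ->
  howe_group k l -> Sp g -> agree k g -> agree k (g *m l).
Proof.
rewrite /agree /whittaker => Ck lB lk gS; have lS := lk.1.
rewrite (repM hrho) // (repM hrho') //.
rewrite (howe_vector_lower hvarpi hpsi hmu hrho hC hfix Ck lB lk).
by rewrite (howe_vector_lower hvarpi hpsi hmu hrho' hC hfix' Ck lB lk).
Qed.

Lemma agree_average k m g : (k <= m)%N -> Sp g ->
  (forall x, U_ m x -> agree k (g *m x)) -> agree m g.
Proof.
move=> km gS h; rewrite /agree /whittaker.
have [inf|] := eqVneq (mu (U_ m)) +oo%E.
  rewrite (howe_vector_infinite hvarpi _ rho _ inf).
  by rewrite (howe_vector_infinite hvarpi _ rho' _ inf) !linear0.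
rewrite -ltey => fin; have [r hr] := transversal_exists (@Uni_Sp F n)
  (@Uni_closed F n) hmu (@open_subgroup_howe F n k) (@open_subgroup_howe F n m)
  (@howe_group_Uni_sub F n k m km) fin.
rewrite (howe_vector_average hvarpi hpsi hmu hrho hfix km fin hr).
rewrite (howe_vector_average hvarpi hpsi hmu hrho' hfix' km fin hr).
move: h; rewrite /agree /whittaker.
move: (howe_vector _ _ rho _ _ _) (howe_vector _ _ rho' _ _ _) => z z' h.
rewrite !linearZ /=; congr (_ * _); rewrite !linear_sum /=.
rewrite big_seq [RHS]big_seq; apply: eq_bigr => x xr.
have hx : U_ m x by case: hr => _ + _; apply.
have xS := Uni_Sp hx.1; rewrite !linearZ /=; congr (_ * _).
by have := h x hx; rewrite (repM hrho) // (repM hrho').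
Qed.

Lemma root_tilt_howe_group k m (X Y : pred I) l : (3 * k <= m)%N ->
  opposite (@Uni F n) l -> one_plus (root_tilt (howe_weight m) m%:Z X Y) l ->
  howe_group k l.
Proof.
move=> km /opposite_UniP[lS ll] hl; split=> //.
apply: one_plus_unisupported ll _ hl => a b ab ba.
have [d ed] : exists d, (a : nat) = (b + d.+1)%N.
  exists (a - b.+1)%N; move: ab ba; rewrite /= leEord -val_eqE /=; lia.
rewrite howe_tiltE /root_tilt /tilt /howe_weight ed.
by move: (X a) (Y b) => [] []; nia.
Qed.

Lemma agree_degenerates k m s t u : (C <= k)%N -> (3 * k <= m)%N ->
  (forall g, lower_cells s g -> agree k g) -> Tor t ->
  degenerates (howe_weight m) m%:Z s u -> agree k (t *m word_mx F s *m u).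
Proof.
move=> Ck km IH ht [c [g [X [Y [hc e gS dXY fg]]]]].
have m0 : 0 <= m%:Z by [].
have [b [l [eg hb [lO fl]]]] := Sp_one_plus_Bor_oppUni
  (root_tilt_subadditive _ m0 dXY) (fun a => root_tilt_diag _ a m0 dXY) gS fg.
have hcell : lower_cells s (t *m c *m b).
  have [s' ss' cell] := hc; exists s' => //.
  exact: bruhat_cellM (Tor_Bor ht) hb cell.
have -> : t *m word_mx F s *m u = t *m c *m b *m l.
  by rewrite -!mulmxA e eg !mulmxA.
apply: (agree_lower_mulr Ck); last exact: IH.
- exact: Uni_Bor.
- exact: root_tilt_howe_group km lO fl.
- by have [s' _ /bruhat_cell_Sp] := hcell.
Qed.

Lemma splits_mulr m s u x : U_ m x -> splits s (U_ m) (u *m x) -> splits s (U_ m) u.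
Proof.
move=> hx [u' [h [e hu' hw hh]]]; exists u', (h *m invmx x); split=> //.
  by rewrite mulmxA -e mulmxK // (mxg_unit hx).
exact: mxgM hh (mxgV hx).
Qed.

Lemma agree_not_splits k m s t u : (C <= k)%N -> (3 * k <= m)%N -> ascending 1 s ->
  (forall g, lower_cells s g -> agree k g) ->
  Tor t -> Uni u -> ~ splits s (U_ m) u -> agree m (t *m word_mx F s *m u).
Proof.
move=> Ck km asc IH ht hu ns; have wS := Sp_word_mx F s; have tS := Tor_Sp ht.
apply: (@agree_average k); first by lia.
  by apply: mxgM (Uni_Sp hu); apply: mxgM.
move=> x hx; rewrite -mulmxA.
have [[u' [h [e hu' hw [hS sh fh]]]]|dg] := splits_or_degenerates
  (@howe_weight_rev n m) (isT : 0 <= m%:Z) (@rev_equivariant1 n) asc (mxgM hu hx.1).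
  case: ns; apply: (splits_mulr hx); exists u', h; split=> //.
  split; first exact: Uni_concordant hS sh.
  by split=> //; apply: one_plus_le fh => a b; rewrite /tilt /= !perm1.
apply: (agree_degenerates Ck km IH ht).
by congr degenerates: dg; apply/funext => a /=; rewrite perm1.
Qed.

Definition agree_torus k (w : set M) := forall x t, w x -> Tor t -> agree k (t *m x).

Lemma agree_splits m s t u : agree_torus m (@weyl_word F n s) ->
  Tor t -> splits s (U_ m) u -> agree m (t *m word_mx F s *m u).
Proof.
move=> H ht [u' [h [-> hu' hw hh]]].
have tS := Tor_Sp ht; have wS := Sp_word_mx F s; have ut := mxg_unit tS.
rewrite mulmxA; apply: agree_Um_mulr => //.
  by apply: mxgM (Uni_Sp hu'); apply: mxgM.
have -> : t *m word_mx F s *m u' = (t *m (word_mx F s *m u' *m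
    invmx (word_mx F s)) *m invmx t) *m (t *m word_mx F s).
  by rewrite !mulmxA mulmxKV // mulmxKV // word_mx_unit.
apply: agree_Uni_mull; [exact: Uni_conj_Tor|exact: mxgM|].
exact: H (word_mx_in_weyl_word F s) ht.
Qed.

Lemma agree_torus_rep k s x : weyl_word s x ->
  (forall t, Tor t -> agree k (t *m x)) -> agree_torus k (weyl_word s).
Proof.
move=> /weyl_word_torus[t1 ht1 ->] H y t /weyl_word_torus[t2 ht2 ->] ht.
have := H (t *m t2 *m invmx t1) (mxgM (mxgM ht ht2) (mxgV ht1)).
by rewrite !mulmxA mulmxKV ?(mxg_unit ht1).
Qed.

Section CellInduction.
Variables (len : nat) (a : nat -> nat).
Hypothesis ha : forall j, (0 < j <= len)%N -> (j + a j.-1 <= a j)%N.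

Lemma agree_not_splits_level m s t u : (size s <= len)%N -> ascending 1 s ->
  (forall s' k g, subseq s' s -> (size s' < size s)%N ->
     (4 ^ a (size s') * C <= k)%N -> bruhat_cell (word_mx F s') g -> agree k g) ->
  (4 ^ a (size s) * C <= m)%N -> Tor t -> Uni u -> ~ splits s (U_ m) u ->
  agree m (t *m word_mx F s *m u).
Proof.
move=> sl asc H hm ht hu ns.
have s0 : (0 < size s)%N.
  rewrite lt0n; apply: contra_notN ns => /eqP/size0nil ->.
  by apply: splits_nil => //; apply: mxg1.
have km : (3 * (4 ^ a (size s).-1 * C) <= m)%N.
  by apply: (level_step ha) hm; rewrite s0.
apply: (agree_not_splits _ km asc _ ht hu ns); first by rewrite leq_pmull // expn_gt0.
move=> g [s' [ss' lt]]; apply: H => //.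
apply: (level_bound_mono ha) (leqnn _).
by rewrite -ltnS prednK ?lt ?(leq_trans (leq_pred _) sl).
Qed.

Lemma agree_bruhat_cell s k g : (size s <= len)%N ->
  (forall s' k', subseq s' s -> (4 ^ a (size s') * C <= k')%N ->
     agree_torus k' (@weyl_word F n s')) ->
  (4 ^ a (size s) * C <= k)%N -> bruhat_cell (word_mx F s) g -> agree k g.
Proof.
have [N sN] := ubnP (size s); elim: N s sN k g => // N IH s sN k g sl H hk hg.
have IHsub s' k' g' : subseq s' s -> (size s' < size s)%N ->
    (4 ^ a (size s') * C <= k')%N -> bruhat_cell (word_mx F s') g' -> agree k' g'.
  move=> ss' lt; apply: IH; [exact: leq_trans lt sN|exact: leq_trans (ltnW lt) sl|].
  by move=> s2 k2 ss2; apply: H; apply: subseq_trans ss2 ss'.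
have [asc|/not_ascending_shorten[s' [ss' lt] /(@eq_weyl_word F) e]] :=
  boolP (ascending 1 s); last first.
  apply: (IHsub s') => //; first by apply: (level_bound_mono ha) hk; rewrite (ltnW lt).
  apply: bruhat_cell_weyl_word hg; last exact: word_mx_in_weyl_word.
  by rewrite e; apply: word_mx_in_weyl_word.
have [u [t [u' [hu ht hu' ->]]]] := bruhat_cell_normal_form hg.
apply: agree_Uni_mull => //.
  by apply: mxgM (Uni_Sp hu'); apply: mxgM (Tor_Sp ht) (Sp_word_mx F s).
have [sp|ns] := pselect (splits s (U_ k) u'); last exact: agree_not_splits_level.
by apply: agree_splits => //; apply: H.
Qed.

Lemma agree_Uminus m s t u : (size s <= len)%N -> ascending 1 s -> (0 < m)%N ->
  (forall s' k', subseq s' s -> (size s' < size s)%N ->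
     (4 ^ a (size s') * C <= k')%N -> agree_torus k' (@weyl_word F n s')) ->
  (4 ^ a (size s) * C <= m)%N -> Tor t -> Uminus (weyl_word s) u ->
  ~ howe_group m u -> agree m (t *m word_mx F s *m u).
Proof.
move=> sl asc m0 H hm ht hu nu; have [uU _] := Uminus_Uni_conj_opposite hvarpi hu.
apply: agree_not_splits_level => //; last first.
  by move=> sp; apply: nu; apply: (Uminus_splits_howe_group hvarpi m0 hu sp).
move=> s' k g ss' lt hk; apply: agree_bruhat_cell => //.
  exact: leq_trans (ltnW lt) sl.
move=> s2 k2 ss2; apply: H; first exact: subseq_trans ss2 ss'.
exact: leq_ltn_trans (size_subseq ss2) lt.
Qed.

End CellInduction.

Lemma bruhat_lt_proper_subword (w : set M) s s' :
  reduced_word w s -> subseq s' s -> (size s' < size s)%N ->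
  bruhat_lt (weyl_word s') w.
Proof.
move=> rs ss' lt; split; first by exists s, s'.
by move=> e; have := weyl_length_le F s'; rewrite e -rs.2 leqNgt lt.
Qed.

Section Representatives.
Variables (rep : set M -> M) (w : set M) (s : seq 'I_n) (a : nat -> nat) (m : nat).
Hypotheses (hrep : forall x : set M, weyl x -> x (rep x)) (rs : reduced_word w s).
Hypothesis ha : forall j, (0 < j <= weyl_length w)%N -> (j + a j.-1 <= a j)%N.
Hypothesis hm : (4 ^ a (weyl_length w) * C <= m)%N.

Lemma agree_torus_subword s' k : subseq s' s -> (4 ^ a (size s') * C <= k)%N ->
  ((4 ^ a (weyl_length (@weyl_word F n s')) * C <= k)%N ->
   forall t, Tor t -> agree k (t *m rep (weyl_word s'))) ->
  agree_torus k (weyl_word s').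
Proof.
move=> ss' hk H; apply: agree_torus_rep (hrep (weyl_weyl_word F s')) (H _).
by apply: (level_bound_mono ha) hk; rewrite weyl_length_le -rs.2 size_subseq.
Qed.

Lemma agree_Uminus_setD_Um :
  (forall w' k t, weyl w' -> bruhat_lt w' w ->
     (4 ^ a (weyl_length w') * C <= k)%N -> Tor t -> agree k (t *m rep w')) ->
  forall t u, Tor t -> (Uminus w `\` Uminus_m varpi w m) u -> agree m (t *m rep w *m u).
Proof.
move=> H t u ht [hu nu]; have [ew sz] := rs.
have m0 : (0 < m)%N by apply: leq_trans hm; rewrite muln_gt0 hC expn_gt0.
have [t' ht' ->] : exists2 t', Tor t' & rep w = t' *m word_mx F s.
  by apply: weyl_word_torus; rewrite ew; apply: hrep; rewrite -ew; apply: weyl_weyl_word.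
rewrite mulmxA; apply: (agree_Uminus ha) => //; rewrite ?sz ?ew //.
- by apply: (@reduced_word_ascending F); rewrite ew.
- move=> s' k ss' lt hk; apply: agree_torus_subword => // hk' t1 ht1.
  apply: H => //; first exact: weyl_weyl_word.
  by apply: (bruhat_lt_proper_subword rs); rewrite ?sz.
- exact: mxgM.
- by move=> um; apply: nu; split; rewrite ?HgrpE.
Qed.

Lemma agree_bruhat_cell_rep :
  (forall w' k t, weyl w' -> bruhat_le w' w ->
     (4 ^ a (weyl_length w') * C <= k)%N -> Tor t -> agree k (t *m rep w')) ->
  forall g, bruhat_cell (rep w) g -> agree m g.
Proof.
move=> H g hg; have [ew sz] := rs.
apply: (@agree_bruhat_cell _ _ ha s) => [|s' k ss' hk||]; rewrite ?sz //.
  apply: agree_torus_subword => // hk' t ht.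
  by apply: H => //; [apply: weyl_weyl_word|exists s, s'].
apply: bruhat_cell_weyl_word (word_mx_in_weyl_word F s) _ hg.
by rewrite ew; apply: hrep; rewrite -ew; apply: weyl_weyl_word.
Qed.

End Representatives.

End Comparison.

Theorem theorem3p11 (R : realType) (F : padicFieldType) (n : nat)
  (hn : (1 < n)%N)
  (varpi : F) (hvarpi : uniformizer varpi)
  (psi : F -> R[i]) (hpsi : additive_character_of_conductor_O psi)
  (mu : {measure set (borel_mx F n) -> \bar R})
  (hmu : haar_measure (@Uni F n) mu)
  (V V' : lmodType R[i])
  (rho : 'M[F]_(n + n) -> {linear V -> V})
  (rho' : 'M[F]_(n + n) -> {linear V' -> V'})
  (hrho : representation rho) (hrho' : representation rho')
  (hsm : smooth_rep rho) (hsm' : smooth_rep rho')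
  (hirr : irreducible_rep rho) (hirr' : irreducible_rep rho')
  (lambda : {scalar V}) (lambda' : {scalar V'})
  (hlambda : whittaker_functional psi rho lambda)
  (hlambda' : whittaker_functional psi rho' lambda')
  (omega : 'M[F]_(n + n) -> R[i])
  (homega : central_character rho omega)
  (homega' : central_character rho' omega)
  (v : V) (v' : V')
  (hv : whittaker rho lambda v 1%:M = 1)
  (hv' : whittaker rho' lambda' v' 1%:M = 1)
  (C : nat) (hC : (0 < C)%N)
  (hfix : forall k, Kgrp C k -> rho k v = v)
  (hfix' : forall k, Kgrp C k -> rho' k v' = v')
  (rep : set 'M[F]_(n + n) -> 'M[F]_(n + n))
  (hrep : forall x, weyl x -> x (rep x))
  (w : set 'M[F]_(n + n)) (hw : weyl w) (hw0 : bruhat_le w (@w0 F n))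
  (a : nat -> nat) (ha0 : a 0%N = 0%N)
  (ha : forall t, (0 < t <= weyl_length w)%N -> (t + a t.-1 <= a t)%N)
  (m : nat) (hm : (4 ^ a (weyl_length w) * C <= m)%N) :
  let W k := whittaker rho lambda (howe_vector varpi psi rho mu k v) in
  let W' k := whittaker rho' lambda' (howe_vector varpi psi rho' mu k v') in
  ((forall w' k t, weyl w' -> bruhat_lt w' w ->
      (4 ^ a (weyl_length w') * C <= k)%N -> Tor t ->
      W k (t *m rep w') = W' k (t *m rep w')) ->
   forall t u, Tor t -> (Uminus w `\` Uminus_m varpi w m) u ->
     W m (t *m rep w *m u) = W' m (t *m rep w *m u))
  /\
  ((forall w' k t, weyl w' -> bruhat_le w' w ->
      (4 ^ a (weyl_length w') * C <= k)%N -> Tor t ->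
      W k (t *m rep w') = W' k (t *m rep w')) ->
   forall g, bruhat_cell (rep w) g -> W m g = W' m g).
Proof.
move=> W W'; have [s rs] : exists s, reduced_word w s.
  by case: hw0 => _ [s' [_ _ ->]]; apply: reduced_word_exists.
split.
- exact: (agree_Uminus_setD_Um hvarpi hpsi hmu hrho hrho' hlambda hlambda'
    hC hfix hfix' hrep rs ha hm).
- exact: (agree_bruhat_cell_rep hvarpi hpsi hmu hrho hrho' hlambda hlambda'
    hC hfix hfix' hrep rs ha hm).
Qed.
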